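(* Let $(V_i)_{i\ge2}$ be i.i.d. random variables with law $\mathcal{L}$ on $[0,1]$. For each $n$ let $K=K^{(n)}$ be the random birth-and-death Markov kernel on $\{1,\dots,n\}$ given by $$K_{1,2}=1,\quad K_{n,n-1}=1,\quad K_{i,i+1}=V_i,\quad K_{i,i-1}=1-V_i\quad(2\le i\le n-1),$$ all other entries being zero. Let $\mu_K=\frac1n\sum_{k=1}^n\delta_{\lambda_k(K)}$ be the empirical distribution of its eigenvalues. Then there exists a non-random probability distribution $\mu$ on $[-1,+1]$ such that almost surely $$\lim_{n\to\infty}W_p(\mu_K,\mu)=0\quad\text{for every }p\ge1.$$ The limiting spectral distribution $\mu$ is fully characterized by its sequence of moments, given for every integer $k\ge1$ by $$\int_{-1}^{+1}x^{2k-1}\,\mu(dx)=0\quad\text{and}\quad\int_{-1}^{+1}x^{2k}\,\mu(dx)=\sum_{\gamma\in D_k}\prod_{i\in\mathbb{Z}}\mathbb{E}\left(V^{N_\gamma(i)}(1-V)^{N_\gamma(i-1)}\right),$$ where $V$ is a random variable of law $\mathcal{L}$, $$D_k=\{\gamma=(\gamma_0,\dots,\gamma_{2k}):\gamma_0=\gamma_{2k}=0\text{ and }|\gamma_\ell-\gamma_{\ell+1}|=1\text{ for every }0\le\ell\le2k-1\}$$ is the set of loop paths of length $2k$ of the simple random walk on $\mathbb{Z}$, and $$N_\gamma(i)=\sum_{\ell=0}^{2k-1}\mathbf{1}_{\{(\gamma_\ell,\gamma_{\ell+1})=(i,i+1)\}}$$ is the number of times $\gamma$ crosses the horizontal line $y=i+\frac12$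 in the increasing direction.
   Context: The eigenvalues $\lambda_1(K),\dots,\lambda_n(K)$ of the tridiagonal stochastic matrix $K$ (counted with algebraic multiplicity) are real and lie in $[-1,1]$. In the moment formula the paths $\gamma$ take values in $\mathbb{Z}$ and $0^0=1$, so all but finitely many factors of each product equal $1$. For real $p\ge1$ and probability measures $\mu,\nu$ on $\mathbb{R}$, the Wasserstein distance is $W_p(\mu,\nu)=\inf_\Pi\left(\int_{\mathbb{R}\times\mathbb{R}}|x-y|^p\,\Pi(dx,dy)\right)^{1/p}$, the infimum being over all probability measures $\Pi$ on $\mathbb{R}^2$ with marginals $\mu$ and $\nu$. *)

(* Defs.v *)
From HB Require Import structures.
From mathcomp Require Import all_boot all_order all_algebra finmap.
From mathcomp Require Import zify polyrcf.
From mathcomp Require Import all_classical all_reals all_analysis.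

Set Implicit Arguments.
Unset Strict Implicit.
Unset Printing Implicit Defensive.

Import Order.TTheory GRing.Theory Num.Theory.
Import numFieldNormedType.Exports.

Local Open Scope classical_set_scope.
Local Open Scope ring_scope.

Section probability_notions.
Context {d : measure_display} {T : measurableType d} {R : realType}.
Variable P : probability T R.

(* Mutual independence of the family (X_i)_{i in I}: the product rule over
   every finite subfamily. *)
Definition mutually_independent (I : set nat) (X : nat -> {RV P >-> R}) :=
  forall (J : {fset nat}) (A : nat -> set R),
    [set` J] `<=` I ->
    (forall i, measurable (A i)) ->
    P (\bigcap_(i in [set` J]) (X i @^-1` A i)) =
    (\prod_(i <- J) P (X i @^-1` A i))%E.

Definition has_law (X : {RV P >-> R}) (L : probability R R) :=
  forall A : set R, measurable A -> distribution P X A = L A.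

Definition iid (I : set nat) (X : nat -> {RV P >-> R}) (L : probability R R) :=
  mutually_independent I X /\ (forall i, I i -> has_law (X i) L).

End probability_notions.

Section wasserstein.
Context {R : realType}.

Definition coupling (mu nu : {measure set R -> \bar R}) :
    set (probability (R * R)%type R) :=
  [set Pi : probability (R * R)%type R | forall A : set R, measurable A ->
    Pi (A `*` setT) = mu A /\ Pi (setT `*` A) = nu A].

(* The value is +oo when there is no coupling, e.g. when one of the two
   measures does not have total mass 1. *)
Definition wasserstein (p : R) (mu nu : {measure set R -> \bar R}) : \bar R :=
  ereal_inf [set ((\int[Pi]_z (`|z.1 - z.2| `^ p)%:E) `^ p^-1)%E
            | Pi in coupling mu nu].

End wasserstein.

Section spectrum.
Context {R : realType}.

(* The real eigenvalues of A, each repeated according to its multiplicity as a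
   root of the characteristic polynomial; there are n of them exactly when
   char_poly A splits over R. *)
Definition eigenvalues n (A : 'M[R]_n) : seq R :=
  flatten [seq nseq (mup x (char_poly A)) x | x <- rootsR (char_poly A)].

Lemma eigenvalues_split n (A : 'M[R]_n) (s : seq R) :
  char_poly A = \prod_(x <- s) ('X - x%:P) -> perm_eq (eigenvalues A) s.
Proof.
move=> Es; have p0 : char_poly A != 0 by rewrite monic_neq0 ?char_poly_monic.
apply/allP => x _ /=; apply/eqP; transitivity (mup x (char_poly A)).
  rewrite /eigenvalues count_flatten -map_comp sumnE big_map.
  under eq_bigr do rewrite /= count_nseq /=.
  have uR : uniq (rootsR (char_poly A)) by exact: uniq_roots.
  have [xR|xR] := boolP (x \in rootsR (char_poly A)).
    rewrite (bigD1_seq x) //= big1 => [|y /negPf -> //].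
    by rewrite addn0 eqxx; exact: mul1n.
  rewrite mupNroot; last first.
    by move: xR; rewrite -(roots_on_rootsR p0) in_itv.
  rewrite big_seq big1 // => y yR; case: eqP => [yx|_]; last by rewrite mul0n.
  by move: xR; rewrite -yx yR.
rewrite {}Es; elim: s {p0} => [|y s IHs]; first by rewrite big_nil mupNroot ?root1.
rewrite big_cons mupM ?polyXsubC_eq0 ?monic_neq0 ?monic_prod_XsubC //.
by rewrite IHs /= -['X - y%:P]expr1 mup_XsubCX eq_sym; case: eqP.
Qed.

Definition empirical_spectral_measure n (A : 'M[R]_n) :
    {measure set R -> \bar R} :=
  mscale (n%:R^-1)%:nng
    (msum (fun k => \d_((eigenvalues A)`_k)) (size (eigenvalues A))).

(* Row i : 'I_n stands for the state i.+1 of {1, ..., n}; v is indexed by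
   states, and only v 2, ..., v n.-1 are used. *)
Definition birth_death_kernel (n : nat) (v : nat -> R) : 'M[R]_n :=
  \matrix_(i, j)
    let a := i.+1 in let b := j.+1 in
    if b == a.+1 then (if a == 1%N then 1 else v a)
    else if a == b.+1 then (if a == n then 1 else 1 - v a)
    else 0.

End spectrum.

Definition loop_paths (k : nat) : set ((2 * k).+1.-tuple int) :=
  [set g : (2 * k).+1.-tuple int | [/\ g`_0 = 0, g`_(2 * k) = 0 &
    forall l, (l < 2 * k)%N -> `|g`_l - g`_l.+1| = 1]].
Arguments loop_paths : clear implicits.

Definition upcrossings (k : nat) (g : (2 * k).+1.-tuple int) (i : int) : nat :=
  (\sum_(0 <= l < 2 * k) ((g`_l, g`_l.+1) == (i, i + 1))%R)%N.

Lemma finite_loop_paths k : finite_set (loop_paths k).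
Proof.
pose f (h : (2 * k).+1.-tuple 'I_(4 * k).+1) : (2 * k).+1.-tuple int :=
  [tuple of map (fun a : 'I_(4 * k).+1 => (a : nat)%:Z - (2 * k)%:Z) h].
apply: (@sub_finite_set _ _ (f @` setT)); last exact/finite_image/finite_finset.
move=> g [g0 _ gS].
have bnd l : (l <= 2 * k)%N -> `|g`_l| <= l%:Z.
  elim: l => [|l IHl] lk; first by rewrite g0.
  by have := IHl (ltnW lk); have := gS l lk; lia.
exists [tuple of map (fun x : int => inord `|(x + (2 * k)%:Z)%R|%N) g] => //.
apply/val_inj => /=; rewrite -map_comp -[RHS]map_id.
apply/eq_in_map => x /(nthP 0)[l]; rewrite size_tuple => lk <- /=.
have := bnd l lk; move: (g`_l) lk => y lk yl.
by rewrite inordK; lia.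
Qed.

Section limit_moments.
Context {R : realType}.

(* 'E_L below is the expectation over the probability space (R, L), on which
   V is the identity. *)
Definition loop_factor (L : probability R R) (k : nat)
    (g : (2 * k).+1.-tuple int) (i : int) : R :=
  fine ('E_L[fun x : R => x ^+ upcrossings g i *
                          (1 - x) ^+ upcrossings g (i - 1)]).

(* The sum and the product are finitely supported big operators: loop_paths k
   is finite, and all but finitely many factors are equal to 1. *)
Definition limit_even_moment (L : probability R R) (k : nat) : R :=
  \sum_(g \in loop_paths k)
    \big[*%R/1]_(i \in [set: int]) loop_factor L g i.

Definition limit_moments (L mu : probability R R) :=
  forall k : nat, (1 <= k)%N ->
    (\int[mu]_(x in `[(-1)%R, 1%R]) (x ^+ (2 * k - 1))%:E)%E = 0%:E /\
    (\int[mu]_(x in `[(-1)%R, 1%R]) (x ^+ (2 * k))%:E)%E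
      = (limit_even_moment L k)%:E.

End limit_moments.

(* Main.v *)
Require Import Defs.
From HB Require Import structures.
From mathcomp Require Import all_boot all_order all_algebra finmap.
From mathcomp Require Import spectral complex ring lra zify.
From mathcomp Require Import all_classical all_reals all_analysis.
From mathcomp Require Import measurable_realfun.

Set Implicit Arguments.
Unset Strict Implicit.
Unset Printing Implicit Defensive.

Import Order.TTheory GRing.Theory Num.Theory.
Import numFieldNormedType.Exports.

Local Open Scope classical_set_scope.
Local Open Scope ring_scope.

(** The proof is the method of moments, followed by a deterministic passage from
    moments to Wasserstein distances.

    Spectrum. The characteristic polynomial of a tridiagonal matrix with zero
    diagonal depends only on the products of its symmetric pairs of entries, so
    the kernel K has the characteristic polynomial of a real symmetric matrix, which splits
    ([birth_death_char_poly_split]). K is nonnegative with row sums at most one, which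
    puts the eigenvalues in [-1, 1], and the m-th moment of the empirical
    spectral measure is tr(K^m) / n.

    Trace. A diagonal entry of K^m at distance at least m from both ends is a sum
    over closed walks of length m. A closed walk steps down from i as often as it
    steps up from i - 1, so the weight of a walk is the product over the sites of
    the monomials V_i^N(i) (1 - V_i)^N(i - 1), and it involves only the window of
    2m + 1 variables around the starting site. Up to a term bounded
    independently of n, tr(K^m) is therefore a sum of one and the same bounded
    function of the consecutive windows ([trace_loop_weight]). Windows that do
    not overlap are independent; with second moments along the squares and
    interpolation between them, the averages converge almost surely
    ([window_lln]), and independence inside a window turns the limit into the
    product of expectations of the statement. For odd m there is no closed walk.
    There are countably many m, so one event of probability one serves them all
    ([ae_trace_cvg]).

    From moments to distances. Let the moments of probability measures on
    [-1, 1] converge. Polynomials approximate Lipschitz functions uniformly, so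
    the integrals of piecewise linear approximations of the indicators of
    half-lines form Cauchy sequences. For 0 < u < v < 1 it follows that the upper limit of
    the quantile functions q_n at u is at most their lower limit at v; these two
    limits then differ at countably many points only, and q_n converges almost
    everywhere to a quantile function q. The image mu of the uniform law under q
    has the limits as its moments, and the coupling (q_n, q) together with
    bounded convergence gives W_p -> 0 for every p at once
    ([cvg_moments_wasserstein]). The same approximation shows that a measure on
    [-1, 1] is determined by its moments ([moment_determinacy]): hence mu does
    not depend on the sample point, and it is the only measure with the stated
    moments. *)

(** * Traces of powers and eigenvalues *)

Lemma is_trig_mxM (R : pzRingType) n (A B : 'M[R]_n) :
  is_trig_mx A -> is_trig_mx B ->
  is_trig_mx (A *m B) /\ forall i, (A *m B) i i = A i i * B i i.
Proof.
move=> /is_trig_mxP tA /is_trig_mxP tB; split.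
  apply/is_trig_mxP => i j ij; rewrite mxE big1 // => k _.
  have [ik|ki] := ltnP i k; first by rewrite tA // mul0r.
  by rewrite tB ?mulr0 // (leq_ltn_trans ki).
move=> i; rewrite mxE (bigD1 i) //= big1 ?addr0 // => k ki.
have [ik|ik] := ltnP i k; first by rewrite tA // mul0r.
by rewrite tB ?mulr0 // ltn_neqAle ki.
Qed.

Lemma is_trig_mxX (R : pzRingType) n (A : 'M[R]_n) m : is_trig_mx A ->
  is_trig_mx (A ^+ m) /\ forall i, (A ^+ m) i i = A i i ^+ m.
Proof.
move=> tA; elim: m => [|m [tm dm]].
  rewrite expr0; split; last by move=> i; rewrite mxE eqxx.
  by apply/is_trig_mxP => i j ij; rewrite mxE; case: eqP ij => // ->; rewrite ltnn.
have [t d] := is_trig_mxM tA tm.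
by rewrite exprS; split=> // i; rewrite -[A * A ^+ m]/(A *m A ^+ m) d dm exprS.
Qed.

(** Schur triangularisation: a matrix similar to A is triangular, and the power of
    a triangular matrix has the powers of the diagonal entries on its diagonal. *)
Lemma mxtrace_exp_eigenvalues (C : numClosedFieldType) n (A : 'M[C]_n)
    (s : seq C) m :
  char_poly A = \prod_(x <- s) ('X - x%:P) ->
  \tr (A ^+ m) = \sum_(x <- s) x ^+ m.
Proof.
case: n A => [|n] A cA.
  rewrite /mxtrace big_ord0.
  move: cA; rewrite /char_poly det_mx00 => /(congr1 (fun p : {poly C} => size p)).
  by rewrite size_prod_XsubC size_poly1 => -[/esym/size0nil ->]; rewrite big_nil.
have [P Pu tT] := Schur A (ltn0Sn n).
have {}Pu := unitarymx_unit Pu.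
have /(simmxP Pu) PA : simmx_for P A (conjmx P A) by apply/(simmxRL Pu); rewrite conjumx.
set T := conjmx P A in PA tT.
have AE : A = invmx P *m T *m P by rewrite -mulmxA -PA mulKmx.
have trE k : \tr (A ^+ k) = \tr (T ^+ k).
  have -> : A ^+ k = invmx P *m T ^+ k *m P.
    elim: k => [|k IH]; first by rewrite !expr0 mulmx1 mulVmx.
    by rewrite !exprS -![_ * _ ^+ k]/(_ *m _ ^+ k) IH {1}AE !mulmxA mulmxK.
  by rewrite -mulmxA mxtrace_mulC -mulmxA mulmxV // mulmx1.
have cT : char_poly A = char_poly T.
  have h : map_mx polyC P *m char_poly_mx A = char_poly_mx T *m map_mx polyC P.
    rewrite /char_poly_mx mulmxBr mulmxBl -!map_mxM PA.
    by rewrite scalar_mxC.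
  move/(congr1 determinant): h; rewrite !det_mulmx mulrC; apply: mulIf.
  by rewrite det_map_mx polyC_eq0 -unitfE -unitmxE.
move: cA; rewrite cT (char_poly_trig tT).
rewrite -(big_map (fun i => T i i) xpredT (fun x => 'X - x%:P)) => cA.
rewrite trE.
have : perm_eq [seq T i i | i <- index_enum 'I_n.+1] s by apply/prod_XsubC_eq.
move=> h; rewrite -(perm_big _ h) big_map; apply: eq_bigr => i _.
by have [_ ->] := is_trig_mxX m tT.
Qed.

(** The spectral theorem holds for Hermitian matrices over R[i]; its diagonal
    matrix has real entries, so the factorisation descends to R. *)
Lemma symmetric_char_poly_split (R : rcfType) n (A : 'M[R]_n) :
  A^T = A -> exists s : seq R, char_poly A = \prod_(x <- s) ('X - x%:P).
Proof.
move=> As.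
pose f := real_complex R; pose B := map_mx f A.
have Breal : B \is a mxOver Num.real.
  by apply/mxOverP => i j; rewrite mxE; apply/complex_realP; exists (A i j).
have Bs : B \is symmetricmx.
  by apply/is_hermitianmxP; rewrite expr0 scale1r map_mx_id ?/B ?map_trmx ?As //.
have Bh := realsym_hermsym Bs Breal.
have [P [D [Pu Dr PB]]] : exists P D, [/\ P \in unitmx, D \is a mxOver Num.real
    & P *m B = diag_mx D *m P].
  exists (spectralmx B), (spectral_diag B); split.
  - exact: spectral_unit.
  - exact: hermitian_spectral_diag_real.
  - have /orthomx_spectralP := hermitian_normalmx Bh.
    move: (spectralmx B) (spectral_diag B) (spectral_unit B) => P D Pu ->.
    by rewrite !mulmxA (mulmxV Pu) mul1mx.
have cB : char_poly B = char_poly (diag_mx D).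
  have h : map_mx polyC P *m char_poly_mx B = char_poly_mx (diag_mx D) *m map_mx polyC P.
    rewrite /char_poly_mx mulmxBr mulmxBl -!map_mxM.
    by rewrite PB scalar_mxC.
  move/(congr1 determinant): h; rewrite !det_mulmx mulrC; apply: mulIf.
  by rewrite det_map_mx polyC_eq0 -unitfE -unitmxE.
exists [seq complex.Re (D 0 i) | i <- index_enum 'I_n].
apply: (map_poly_inj f); rewrite -/f map_char_poly -/B cB.
rewrite char_poly_trig; last exact: diag_mx_is_trig.
rewrite big_map rmorph_prod; apply: eq_bigr => i _.
rewrite rmorphB /= map_polyX map_polyC /= mxE eqxx mulr1n.
by rewrite /f (RRe_real (mxOverP Dr 0 i)).
Qed.

(** * The spectrum of the kernel *)

Definition tridiagonal_mx (R : pzSemiRingType) n (b c : nat -> R) : 'M[R]_n :=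
  \matrix_(i, j) (if j == i.+1 :> nat then b i else if i == j.+1 :> nat then c j else 0).

Lemma map_tridiagonal_mx (R S : pzRingType) (f : {rmorphism R -> S}) n
    (b c : nat -> R) :
  map_mx f (tridiagonal_mx n b c) = tridiagonal_mx n (f \o b) (f \o c).
Proof.
by apply/matrixP => i j; rewrite !mxE; case: ifP => // _; case: ifP; rewrite ?rmorph0.
Qed.

(** Conjugation by the diagonal matrix with entries c_0 ... c_(i-1) moves all the
    weights above the diagonal. *)
Lemma char_poly_tridiagonal_neq0 (R : idomainType) n (b c : nat -> R) :
  (forall i, c i != 0) ->
  char_poly (tridiagonal_mx n b c)
  = char_poly (tridiagonal_mx n (fun i => b i * c i) (fun=> 1)).
Proof.
move=> c0; pose d i := \prod_(k < i) c k.
pose D : 'M[R]_n := diag_mx (\row_i d i).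
have TD : tridiagonal_mx n b c *m D
          = D *m tridiagonal_mx n (fun i => b i * c i) (fun=> 1).
  apply/matrixP => i j; rewrite mul_mx_diag mul_diag_mx !mxE.
  case: ifP => [/eqP ->|_]; first by rewrite /d big_ord_recr /=; ring.
  case: ifP => [/eqP ->|_]; last by rewrite mul0r mulr0.
  by rewrite /d big_ord_recr /= mulr1 mulrC.
have h : char_poly_mx (tridiagonal_mx n b c) *m map_mx polyC D = map_mx polyC D
      *m char_poly_mx (tridiagonal_mx n (fun i => b i * c i) (fun=> 1)).
  by rewrite /char_poly_mx mulmxBr mulmxBl -!map_mxM TD scalar_mxC.
move/(congr1 determinant): h; rewrite !det_mulmx mulrC; apply: mulfI.
rewrite det_map_mx polyC_eq0 det_diag; apply/prodf_neq0 => i _.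
by rewrite mxE; apply/prodf_neq0.
Qed.

(** The diagonal conjugation needs nonzero entries below the diagonal. Replacing c_i
    by c_i + 'X over the ring of polynomials makes them nonzero, and evaluation at 0
    brings the identity back. *)
Lemma char_poly_tridiagonal (R : idomainType) n (b c : nat -> R) :
  char_poly (tridiagonal_mx n b c)
  = char_poly (tridiagonal_mx n (fun i => b i * c i) (fun=> 1)).
Proof.
pose f : {rmorphism {poly R} -> R} := horner_eval 0.
pose b' i : {poly R} := (b i)%:P; pose c' i : {poly R} := (c i)%:P + 'X.
have Eb (b1 b2 c1 c2 : nat -> R) : b1 =1 b2 -> c1 =1 c2 ->
    tridiagonal_mx n b1 c1 = tridiagonal_mx n b2 c2.
  by move=> e1 e2; apply/matrixP => i j; rewrite !mxE e1 e2.
have fb : f \o b' =1 b by move=> i; rewrite /f /= horner_evalE hornerC.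
have fc : f \o c' =1 c.
  by move=> i; rewrite /f /= horner_evalE hornerD hornerC hornerX addr0.
have fbc : f \o (fun i => b' i * c' i) =1 (fun i => b i * c i).
  by move=> i; rewrite -fb -fc /= rmorphM.
have f1 : f \o (fun _ : nat => 1) =1 (fun _ : nat => 1).
  by move=> i; rewrite /f /= horner_evalE hornerC.
rewrite -(Eb _ _ _ _ fb fc) -(Eb _ _ _ _ fbc f1) -!map_tridiagonal_mx.
rewrite -!map_char_poly char_poly_tridiagonal_neq0 // => i.
apply/eqP => /(congr1 (fun p : {poly R} => p`_1)).
rewrite coefD coefC coefX coef0 /= add0r; exact/eqP/oner_neq0.
Qed.

Lemma tridiagonal_mx_row_sum (R : pzRingType) n (b c : nat -> R) (i : 'I_n) :
  \sum_j tridiagonal_mx n b c i j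
  = (if (i.+1 < n)%N then b i else 0) + (if (0 < i)%N then c i.-1 else 0).
Proof.
under eq_bigr => j _.
  rewrite (_ : tridiagonal_mx n b c i j = (if j == i.+1 :> nat then b i else 0)
    + (if (i == j.+1 :> nat) then c j else 0)); last first.
    rewrite mxE; case: eqP => [->|_]; last by rewrite add0r.
    by rewrite ltn_eqF ?addr0.
  over.
rewrite big_split /= -!big_mkcond /= (big_ord1_eq _ (fun=> b i)); congr (_ + _).
case: (posnP i) => [i0|i0]; first by rewrite big_pred0 // => j; rewrite i0.
under eq_bigl => j do rewrite -(prednK i0) eqSS eq_sym.
rewrite (big_ord1_eq _ c) (leq_ltn_trans (leq_pred i)) //; exact: ltn_ord.
Qed.

Section birth_death_spectrum.
Context {R : realType}.
Variables (n : nat) (v : nat -> R).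
Hypothesis v01 : forall i, (2 <= i)%N -> 0 <= v i <= 1.
Let K : 'M[R]_n := birth_death_kernel n v.
Let b i := if i == 0%N then 1 else v i.+1.
Let c i := if i.+2 == n then 1 else 1 - v i.+2.

Let KE : K = tridiagonal_mx n b c.
Proof.
apply/matrixP => i j; rewrite !mxE /= !eqSS.
case: ifP => // _; case: ifP => // /eqP ij.
by rewrite /c ij.
Qed.

Let b01 i : 0 <= b i <= 1.
Proof. by rewrite /b; case: i => [|i] /=; [rewrite ler01 lexx|exact: v01]. Qed.

Let c01 i : 0 <= c i <= 1.
Proof.
rewrite /c; case: ifP; first by rewrite ler01 lexx.
by move=> _; have := @v01 i.+2 isT; lra.
Qed.

Lemma birth_death_kernel_ge0 i j : 0 <= K i j.
Proof.
rewrite KE mxE; case: ifP => _; first by have /andP[] := b01 i.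
by case: ifP => // _; have /andP[] := c01 j.
Qed.

(** The inequality is strict when n = 1, where the kernel is the zero matrix. *)
Lemma birth_death_kernel_row_sum i : \sum_j K i j <= 1.
Proof.
rewrite KE tridiagonal_mx_row_sum; case: (posnP i) => [->|i0].
  by rewrite addr0 /b /=; case: ifP.
rewrite /b /c gtn_eqF // prednK //; case: ifP => i1; first by rewrite ltn_eqF // addrC subrK.
by have := c01 i.-1; rewrite /c prednK // add0r => /andP[].
Qed.

(** The kernel has the characteristic polynomial of the symmetric tridiagonal
    matrix with entries sqrt(b_i c_i), which exists because b_i c_i is nonnegative. *)
Lemma birth_death_char_poly_split :
  exists s : seq R, char_poly K = \prod_(x <- s) ('X - x%:P).
Proof.
pose s i := Num.sqrt (b i * c i).
have [e E] : exists e : seq R,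
    char_poly (tridiagonal_mx n s s) = \prod_(x <- e) ('X - x%:P).
  apply: symmetric_char_poly_split; apply/matrixP => i j; rewrite !mxE.
  case: eqP => [->|_]; last by [].
  by rewrite ltn_eqF.
exists e; rewrite -E KE char_poly_tridiagonal [RHS]char_poly_tridiagonal.
congr char_poly; apply/matrixP => i j; rewrite !mxE.
case: ifP => // _; rewrite -expr2 sqr_sqrtr // mulr_ge0 //.
  by have /andP[] := b01 i.
by have /andP[] := c01 i.
Qed.

(** For a left eigenvector u, summing |x| |u_j| <= sum_i |u_i| K_ij over j bounds
    |x| by the row sums of K. *)
Lemma birth_death_eigenvalue_le1 (x : R) : eigenvalue K x -> `|x| <= 1.
Proof.
case/eigenvalueP => u uK u0.
have S0 : 0 < \sum_i `|u 0 i|.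
  rewrite lt_def sumr_ge0 ?andbT // psumr_neq0 //.
  have [i ui] : exists i, u 0 i != 0.
    apply/existsP; apply: contraNT u0 => /existsPn u0; apply/eqP/rowP => i.
    by rewrite mxE; apply/eqP; rewrite -[_ == _]negbK u0.
  by apply/hasP; exists i; rewrite ?mem_index_enum // normr_gt0.
rewrite -(ler_pM2r S0) mul1r mulr_sumr.
apply: le_trans (_ : \sum_j \sum_i `|u 0 i| * K i j <= _).
  apply: ler_sum => j _.
  rewrite -normrM; have -> : x * u 0 j = (u *m K) 0 j by rewrite uK mxE.
  rewrite mxE; apply: le_trans (ler_norm_sum _ _ _) _.
  by apply: ler_sum => i _; rewrite normrM (ger0_norm (birth_death_kernel_ge0 _ _)).
rewrite exchange_big /=; apply: ler_sum => i _; rewrite -mulr_sumr.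
by rewrite ler_piMr //; exact: birth_death_kernel_row_sum.
Qed.

Lemma birth_death_eigenvalues :
  [/\ size (eigenvalues K) = n,
      {in eigenvalues K, forall x, `|x| <= 1} &
      forall m, \sum_(x <- eigenvalues K) x ^+ m = \tr (K ^+ m)].
Proof.
have [s Es] := birth_death_char_poly_split.
have ps := eigenvalues_split Es; split.
- have : size (char_poly K) = n.+1 by exact: size_char_poly.
  by rewrite Es size_prod_XsubC -(perm_size ps) => -[].
- move=> x; rewrite (perm_mem ps) => xs; apply: birth_death_eigenvalue_le1.
  by rewrite eigenvalue_root_char Es root_prod_XsubC.
- move=> m; rewrite (perm_big _ ps) /=; apply: (fmorph_inj (real_complex R)).
  rewrite -trace_map_mx rmorph_sum rmorphXn /=.
  rewrite (@mxtrace_exp_eigenvalues _ _ _ (map (real_complex R) s)).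
    by rewrite big_map; apply: eq_bigr => x _; rewrite rmorphXn.
  rewrite -map_char_poly Es rmorph_prod big_map; apply: eq_bigr => x _.
  by rewrite rmorphB /= map_polyX map_polyC.
Qed.
End birth_death_spectrum.

(** * Walks and the entries of powers of the kernel *)

Definition walk_step (z : int) (b : bool) : int := if b then z + 1 else z - 1.

(** A walk is encoded by its starting point and the sequence of its steps, where
    true stands for an upward step; translating a walk then keeps the sequence. *)
Fixpoint step_sequences (m : nat) : seq (seq bool) :=
  if m is m'.+1 then
    [seq true :: s | s <- step_sequences m'] ++
    [seq false :: s | s <- step_sequences m']
  else [:: [::]].

Definition walk_end (z : int) (s : seq bool) : int := foldl walk_step z s.

Fixpoint up_steps (z : int) (s : seq bool) (i : int) : nat :=
  if s is b :: s' then (b && (z == i)) + up_steps (walk_step z b) s' i else 0.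

Fixpoint down_steps (z : int) (s : seq bool) (i : int) : nat :=
  if s is b :: s' then (~~ b && (z == i)) + down_steps (walk_step z b) s' i
  else 0.

Lemma mem_step_sequences m s : (s \in step_sequences m) = (size s == m).
Proof.
elim: m s => [|m IHm] [|b s] //=.
  by rewrite mem_cat; apply/negP => /orP[] /mapP[].
rewrite mem_cat eqSS -IHm; case: b.
  rewrite mem_map => [|? ? []] //; rewrite [X in _ || X](_ : _ = false) ?orbF //.
  by apply/negP => /mapP[].
rewrite orbC mem_map => [|? ? []] //; rewrite [X in _ || X](_ : _ = false) ?orbF //.
by apply/negP => /mapP[].
Qed.

Lemma uniq_step_sequences m : uniq (step_sequences m).
Proof.
elim: m => //= m IHm; rewrite cat_uniq !map_inj_uniq ?IHm ?andbT /=.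
- by apply/hasPn => _ /mapP[s _ ->]; apply/negP => /mapP[].
- by move=> ? ? [].
- by move=> ? ? [].
Qed.

Lemma walk_endD z c s : walk_end (z + c) s = walk_end z s + c.
Proof.
elim: s z => //= b s IHs z; rewrite -IHs; congr walk_end.
by rewrite /walk_step; case: b; lia.
Qed.

Lemma up_stepsD z c s i : up_steps (z + c) s (i + c) = up_steps z s i.
Proof.
elim: s z => //= b s IHs z; rewrite (inj_eq (addIr c)) -IHs; congr (_ + up_steps _ _ _)%N.
by rewrite /walk_step; case: b; lia.
Qed.

Lemma down_stepsD z c s i : down_steps (z + c) s (i + c) = down_steps z s i.
Proof.
elim: s z => //= b s IHs z; rewrite (inj_eq (addIr c)) -IHs; congr (_ + down_steps _ _ _)%N.
by rewrite /walk_step; case: b; lia.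
Qed.

(** Crossings of the level i + 1/2 in the two directions alternate, so their numbers
    differ by at most one, according to the sides on which the walk starts and ends. *)
Lemma up_steps_balance z s i :
  (up_steps z s i + ((walk_end z s <= i)%R && (i < z)%R))%N =
  (down_steps z s (i + 1)%R + ((z <= i)%R && (i < walk_end z s)%R))%N.
Proof.
elim: s z => [|b s IHs] z /=; first by rewrite /walk_end /=; lia.
by have := IHs (walk_step z b); rewrite /walk_end /= /walk_step; case: b => /=; lia.
Qed.

(** This identity turns the weight of a closed walk, which counts the steps down
    from i, into the exponent N(i - 1) of the limiting moments. *)
Lemma down_steps_loop z s i : walk_end z s = z ->
  down_steps z s i = up_steps z s (i - 1).
Proof.
move=> zs; have := up_steps_balance z s (i - 1).
by rewrite zs subrK; lia.
Qed.

Lemma up_steps_far z s i : (size s <= `|(i - z)%R|)%N -> up_steps z s i = 0%N.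
Proof.
elim: s z => //= b s IHs z zs; rewrite IHs; last by rewrite /walk_step; case: b; lia.
by rewrite addn0; case: eqP; rewrite ?andbF //; lia.
Qed.

Lemma down_steps_far z s i : (size s <= `|(i - z)%R|)%N -> down_steps z s i = 0%N.
Proof.
elim: s z => //= b s IHs z zs; rewrite IHs; last by rewrite /walk_step; case: b; lia.
by rewrite addn0; case: eqP; rewrite ?andbF //; lia.
Qed.

Fixpoint walk_weight (R : pzRingType) (v : int -> R) (z : int) (s : seq bool) : R :=
  if s is b :: s' then
    (if b then v z else 1 - v z) * walk_weight v (walk_step z b) s'
  else 1.

(** The weight of a walk is regrouped by the site from which each step is made. *)
Lemma walk_weightE (R : comPzRingType) (v : int -> R) z s (S : seq int) :
  uniq S -> (forall i : int, (`|(i - z)%R| < size s)%N -> i \in S) ->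
  walk_weight v z s =
  \prod_(i <- S) (v i ^+ up_steps z s i * (1 - v i) ^+ down_steps z s i).
Proof.
move=> uS; elim: s z => [|b s IHs] z SS /=.
  by rewrite big1 // => i _; rewrite !expr0 mulr1.
rewrite IHs; last by move=> i iz; apply: SS => /=; move: iz; rewrite /walk_step; case: b; lia.
have zS : z \in S by apply: SS => /=; lia.
have -> : (if b then v z else 1 - v z) =
    \prod_(i <- S) (v i ^+ (b && (z == i)) * (1 - v i) ^+ (~~ b && (z == i))).
  rewrite (bigD1_seq z) //= eqxx big1 ?mulr1.
    by case: b {SS}; rewrite /= expr1 expr0 ?mulr1 ?mul1r.
  by move=> i; rewrite eq_sym => /negPf ->; rewrite !andbF !expr0 mulr1.
rewrite -big_split /=; apply: eq_bigr => i _.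
by rewrite !exprD; ring.
Qed.

(** The contribution of one site to the weight of the walk started at 0. The site
    is numbered by t = i + size s, so that the sites within reach of the walk have
    the numbers 0, ..., 2 * size s. *)
Definition site_monomial (R : pzRingType) (s : seq bool) (t : nat) (x : R) : R :=
  let i := t%:Z - (size s)%:Z in x ^+ up_steps 0 s i * (1 - x) ^+ down_steps 0 s i.

Lemma walk_weight_shift (R : comPzRingType) (v : nat -> R) (j : nat) s :
  walk_weight (fun i => v `|i|%N) (j + size s)%:Z s =
  \prod_(t < (2 * size s).+1) site_monomial s t (v (j + t)%N).
Proof.
rewrite (@walk_weightE _ _ _ _ [seq (j + t)%:Z | t <- iota 0 (2 * size s).+1]).
- rewrite big_map -(big_mkord xpredT (fun t => site_monomial s t (v (j + t)%N))).
  rewrite /index_iota subn0; apply: eq_bigr => t _.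
  rewrite /site_monomial -(up_stepsD 0 (j + size s)%:Z) -(down_stepsD 0 (j + size s)%:Z).
  by rewrite add0r absz_nat (_ : t%:Z - (size s)%:Z + (j + size s)%:Z = (j + t)%:Z) //; lia.
- by rewrite map_inj_uniq ?iota_uniq // => a b; lia.
- move=> i ij; apply/mapP; exists `|i - j%:Z|%N; last by lia.
  by rewrite mem_iota; lia.
Qed.

(** Decomposition according to the first step. The hypotheses keep the walk away
    from the two ends of the state space, where the transition probabilities are
    not given by v. *)
Lemma birth_death_kernel_exp (R : realType) n (v : nat -> R) m (i j : 'I_n) :
  (m <= i)%N -> (i + m < n)%N ->
  (birth_death_kernel n v ^+ m) i j =
  \sum_(s <- step_sequences m | walk_end i.+1%:Z s == j.+1%:Z)
     walk_weight (fun z => v `|z|%N) i.+1%:Z s.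
Proof.
elim: m i => [|m IHm] i mi im.
  rewrite expr0 mxE big_mkcond /= big_seq1 /walk_end /= -val_eqE /=.
  by rewrite (_ : (i.+1%:Z == j.+1%:Z) = (i == j :> nat)) //; case: eqP => //; lia.
have ip1 : (i.+1 < n)%N by lia.
have im1 : (i.-1 < n)%N := leq_ltn_trans (leq_pred _) (ltn_ord i).
pose ip := Ordinal ip1; pose id := Ordinal im1.
rewrite exprS -[_ * _]/(birth_death_kernel n v *m _) mxE.
rewrite (bigD1 ip) // (bigD1 id) /=; last by rewrite -val_eqE /=; lia.
rewrite big1 => [|k /andP[kp kd]]; last first.
  rewrite mxE /= !eqSS; move: kp kd; rewrite -!val_eqE /= => /negPf -> kd.
  by case: eqP => [ik|_]; [move: kd; rewrite ik /= eqxx|rewrite mul0r].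
rewrite addr0 !mxE /= eqxx !eqSS ifF; last by lia.
rewrite ifF; last by lia.
rewrite ifT; last by lia.
rewrite ifF; last by lia.
rewrite big_cat !big_map /= !IHm /=; try lia.
rewrite prednK; last by lia.
rewrite !mulr_sumr; congr (_ + _).
- apply: eq_big => [s|s _].
    by rewrite /walk_end /= /walk_step; congr (foldl _ _ _ == _); lia.
  by congr (_ * walk_weight _ _ _); rewrite /walk_step; lia.
- apply: eq_big => [s|s _].
    by rewrite /walk_end /= /walk_step; congr (foldl _ _ _ == _); lia.
  by congr (_ * walk_weight _ _ _); rewrite /walk_step; lia.
Qed.

(** The return probability after m steps in an infinite environment; j is the left
    end of the window of environment that the walk can see, so it starts at j + m. *)
Definition loop_weight (R : pzRingType) (m : nat) (v : nat -> R) (j : nat) : R :=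
  \sum_(s <- step_sequences m | walk_end 0 s == 0)
    \prod_(t < (2 * m).+1) site_monomial s t (v (j + t)%N).

Lemma birth_death_kernel_exp_diag (R : realType) n (v : nat -> R) m (i : 'I_n) :
  (m <= i)%N -> (i + m < n)%N ->
  (birth_death_kernel n v ^+ m) i i = loop_weight m v (i.+1 - m).
Proof.
move=> mi im; rewrite birth_death_kernel_exp // /loop_weight big_seq_cond [RHS]big_seq_cond.
apply: eq_big => [s|s /andP[]].
  by rewrite -[in LHS](add0r i.+1%:Z) walk_endD -{2}(add0r i.+1%:Z) (inj_eq (addIr _)).
rewrite mem_step_sequences => /eqP sm _; subst m.
by rewrite -walk_weight_shift; congr walk_weight; rewrite subnK // ltnW.
Qed.

Section substochastic.
Context {R : numDomainType}.

Lemma substochastic_exp n (A : 'M[R]_n) m :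
  (forall i j, 0 <= A i j) -> (forall i, \sum_j A i j <= 1) ->
  (forall i j, 0 <= (A ^+ m) i j) /\ (forall i, \sum_j (A ^+ m) i j <= 1).
Proof.
move=> A0 A1; elim: m => [|m [P0 P1]].
  rewrite expr0; split=> i; first by move=> j; rewrite mxE ler0n.
  by rewrite (bigD1 i) //= big1 => [|j ji]; rewrite mxE ?eqxx ?addr0 // eq_sym (negPf ji).
rewrite exprS -[_ * _]/(A *m _); split=> i.
  by move=> j; rewrite mxE; apply: sumr_ge0 => k _; rewrite mulr_ge0.
under eq_bigr do rewrite mxE.
rewrite exchange_big /=; apply: le_trans (A1 i); apply: ler_sum => k _.
by rewrite -mulr_sumr ler_piMr.
Qed.

Lemma substochastic_exp_le1 n (A : 'M[R]_n) m i j :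
  (forall i j, 0 <= A i j) -> (forall i, \sum_j A i j <= 1) ->
  0 <= (A ^+ m) i j <= 1.
Proof.
move=> A0 A1; have [P0 P1] := substochastic_exp m A0 A1; rewrite P0 /=.
by apply: le_trans (P1 i); rewrite (bigD1 j) //= lerDl sumr_ge0.
Qed.

End substochastic.

Lemma site_monomial_itv (R : realDomainType) s t (x : R) :
  0 <= x <= 1 -> 0 <= site_monomial s t x <= 1.
Proof.
move=> /andP[x0 x1]; have y0 : 0 <= 1 - x by rewrite subr_ge0.
rewrite /site_monomial mulr_ge0 ?exprn_ge0 //.
by rewrite mulr_ile1 ?exprn_ge0 ?exprn_ile1 // lerBlDr lerDl.
Qed.

Lemma loop_weight_itv (R : realDomainType) m (v : nat -> R) j :
  (forall i, (2 <= i)%N -> 0 <= v i <= 1) -> (2 <= j)%N ->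
  0 <= loop_weight m v j <= (2 ^ m)%:R.
Proof.
move=> v01 j2.
have P01 s : 0 <= \prod_(t < (2 * m).+1) site_monomial s t (v (j + t)%N) <= 1.
  have S01 t : 0 <= site_monomial s t (v (j + t)%N) <= 1.
    by apply: site_monomial_itv; apply: v01; rewrite (leq_trans j2) // leq_addr.
  rewrite prodr_ge0 => [|t _]; last by have /andP[] := S01 t.
  exact: numdomain.Num.Theory.prodr_ile1.
rewrite /loop_weight sumr_ge0 => [|s _]; last by have /andP[] := P01 s.
rewrite big_mkcond /=; apply: le_trans (_ : \sum_(s <- step_sequences m) 1 <= _).
  by apply: ler_sum => s _; case: ifP => // _; have /andP[] := P01 s.
rewrite big_const_seq count_predT iter_addr_0 ler_nat.
elim: m {P01} => //= m IHm; rewrite size_cat !size_map expnS; lia.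
Qed.

(** At most 2m + 1 starting points are within distance m of an end of the state
    space. Their diagonal entries are at most one and the loop weights at most 2^m,
    which bounds the difference independently of n. *)
Lemma trace_loop_weight (R : realType) m n (v : nat -> R) :
  (forall i, (2 <= i)%N -> 0 <= v i <= 1) ->
  `|\tr (birth_death_kernel n v ^+ m) - \sum_(0 <= j < n) loop_weight m v j.+2|
  <= ((2 * m).+2 * (2 ^ m).+1)%:R.
Proof.
move=> v01; set K := birth_death_kernel n v.
pose D k := if insub k is Some i then (K ^+ m) i i else 0.
have trE : \tr (K ^+ m) = \sum_(0 <= k < n) D k.
  by rewrite big_mkord; apply: eq_bigr => i _; rewrite /D valK.
have D01 k : 0 <= D k <= 1.
  rewrite /D; case: insubP => [i _ _|_]; last by rewrite lexx ler01.
  apply: substochastic_exp_le1 => *; first exact: birth_death_kernel_ge0.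
  exact: birth_death_kernel_row_sum.
have Y01 k := @loop_weight_itv R m v k.+2 v01 isT.
have Dle (a b : nat) : 0 <= \sum_(a <= k < b) D k <= (b - a)%:R.
  rewrite sumr_ge0 => [|k _]; last by have /andP[] := D01 k.
  rewrite -sumr_const_nat.
  by rewrite ler_sum //= => k _; have /andP[] := D01 k.
have Yle (a b : nat) : 0 <= \sum_(a <= k < b) loop_weight m v k.+2 <= ((b - a) * 2 ^ m)%:R.
  rewrite sumr_ge0 => [|k _]; last by have /andP[] := Y01 k.
  rewrite natrM mulr_natl -sumr_const_nat.
  by rewrite ler_sum //= => k _; have /andP[] := Y01 k.
rewrite trE.
have [nm|nm] := leqP n (2 * m).+1.
  have := Dle 0 n; have := Yle 0 n; rewrite !subn0.
  move: (\sum_(_ <= _ < _) _) (\sum_(_ <= _ < _) _) => y d /andP[y0 y1] /andP[d0 d1].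
  have : (n * 2 ^ m)%:R + n%:R <= ((2 * m).+2 * (2 ^ m).+1)%:R :> R.
    by rewrite -natrD ler_nat; nia.
  by rewrite ler_norml; lra.
rewrite (@big_cat_nat _ _ _ m.+1 0 n) /=; [|lia..].
rewrite (@big_cat_nat _ _ _ (n - m) m.+1 n) /=; [|lia..].
rewrite (@big_cat_nat _ _ _ (n - (2 * m).+1) 0 n) /=; [|lia..].
have -> : \sum_(m.+1 <= i < n - m) D i =
    \sum_(0 <= i < n - (2 * m).+1) loop_weight m v i.+2.
  rewrite -{1}[m.+1]add0n big_addn (_ : n - m - m.+1 = n - (2 * m).+1)%N; last by lia.
  apply: eq_big_nat => i /andP[_ im].
  have imn : (i + m.+1 < n)%N by lia.
  rewrite /D insubT birth_death_kernel_exp_diag /=; [congr loop_weight; lia|lia..].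
move: (Dle 0 m.+1) (Dle (n - m) n)%N (Yle (n - (2 * m).+1) n)%N.
rewrite !subn0 !subKn; [|lia..].
move: (\sum_(_ <= _ < _) _) (\sum_(_ <= _ < _) _) (\sum_(_ <= _ < _) _) (\sum_(_ <= _ < _) _).
move=> a b c d /andP[a0 a1] /andP[b0 b1] /andP[c0 c1].
have : (m.+1%:R + m%:R) + ((2 * m).+1 * 2 ^ m)%:R <= ((2 * m).+2 * (2 ^ m).+1)%:R :> R.
  by rewrite -!natrD ler_nat; nia.
by rewrite ler_norml; lra.
Qed.

(** * Loop paths and loop moments *)

Definition walk (z : int) (s : seq bool) : seq int := z :: scanl walk_step z s.

Lemma nth_walk z s l : (l <= size s)%N -> (walk z s)`_l = walk_end z (take l s).
Proof. by move=> ls; rewrite /walk nth_cons_scanl. Qed.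

Lemma up_steps_walk z s i :
  (\sum_(0 <= l < size s) (((walk z s)`_l, (walk z s)`_l.+1) == (i, i + 1))%R)%N
  = up_steps z s i.
Proof.
elim: s z => [|b s IHs] z; first by rewrite big_geq.
rewrite big_nat_recl //= -IHs; congr addn.
by rewrite xpair_eqE /walk_step; case: b => /=; case: eqP => // ?; lia.
Qed.

Lemma walk_inj z : injective (walk z).
Proof.
have stepK a : cancel (walk_step a) (fun b => b == a + 1).
  by move=> [|] /=; [rewrite eqxx | apply/eqP; rewrite /walk_step; lia].
move=> s1 s2 [] /(congr1 (pairmap (fun a b : int => b == a + 1) z)).
by rewrite !(scanlK stepK).
Qed.

Lemma nearest_neighbour_walk z (q : seq int) :
  (forall l, (l < size q)%N -> `|(z :: q)`_l - (z :: q)`_l.+1| = 1) ->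
  exists2 s, size s = size q & walk z s = z :: q.
Proof.
elim: q z => [|y q IHq] z zq; first by exists [::].
have [s sq sE] := IHq y (fun l lq => zq l.+1 lq).
exists ((y == z + 1) :: s); first by rewrite /= sq.
have zy : walk_step z (y == z + 1) = y.
  by have := zq 0%N isT; rewrite /walk_step /=; case: eqP => //; lia.
by rewrite /walk /= zy; congr (_ :: _).
Qed.

(** The m-th moment of the limiting law: the product of expectations replaces each
    site monomial of the loop weight by its mean. *)
Definition loop_moment (R : realType) (L : probability R R) (m : nat) : R :=
  \sum_(s <- step_sequences m | walk_end 0 s == 0)
    \prod_(t < (2 * m).+1) fine ('E_L[site_monomial s t]).

(** Step sequences of closed walks enumerate the loop paths, and the factors of the
    sites out of reach are equal to one. *)
Lemma limit_even_momentE (R : realType) (L : probability R R) k :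
  limit_even_moment L k = loop_moment L (2 * k).
Proof.
rewrite /loop_moment.
set m := (2 * k)%N.
pose path s : m.+1.-tuple int := insubd (nseq_tuple m.+1 0) (walk 0 s).
have pathE s : size s = m -> val (path s) = walk 0 s.
  by move=> sm; rewrite val_insubd /= size_scanl sm eqxx.
pose S := [seq s <- step_sequences m | walk_end 0 s == 0].
have Ssize s : s \in S -> size s = m.
  by rewrite mem_filter mem_step_sequences => /andP[_ /eqP].
have loopE : loop_paths k = [set` [seq path s | s <- S]].
  apply/seteqP; split=> [g [g0 gm gl]|_ /mapP[s sS ->]] /=.
    have gE : g`_0 :: behead g = g by case: (g) => -[].
    have [|s sq] := @nearest_neighbour_walk g`_0 (behead g).
      by rewrite size_behead size_tuple gE.
    rewrite gE g0 => /esym sE.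
    have sm : size s = m by rewrite sq size_behead size_tuple.
    apply/mapP; exists s; last by apply: val_inj; rewrite pathE.
    rewrite mem_filter mem_step_sequences sm eqxx andbT.
    by rewrite -[s]take_size -nth_walk // -sE sm gm.
  have sm := Ssize _ sS; split; rewrite pathE //.
    rewrite nth_walk ?sm // -/m -sm take_size.
    by move: sS; rewrite mem_filter => /andP[/eqP].
  move=> l lm; rewrite !nth_walk ?sm //; last by rewrite ltnW.
  rewrite (take_nth false) ?sm // /walk_end -cats1 foldl_cat /= /walk_step.
  by case: ifP; lia.
rewrite /limit_even_moment loopE -fsbig_seq; last first.
  rewrite map_inj_in_uniq ?filter_uniq ?uniq_step_sequences // => s1 s2 /Ssize h1 /Ssize h2.
  by move=> /(congr1 val); rewrite !pathE // => /walk_inj.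
rewrite big_map big_filter [LHS]big_seq_cond [RHS]big_seq_cond.
apply: eq_bigr => s /andP[sm /eqP s0]; rewrite mem_step_sequences in sm.
move/eqP in sm.
have upE i : upcrossings (path s) i = up_steps 0 s i.
  by rewrite /upcrossings pathE // -/m -[in LHS]sm up_steps_walk.
have sites (i : int) : (`|(i - 0)%R| < m)%N ->
    i \in [seq t%:Z - m%:Z | t <- iota 0 (2 * m).+1].
  move=> im; apply/mapP; exists `|(i + m%:Z)%R|%N; last by lia.
  by rewrite mem_iota; lia.
rewrite (fsbigE [seq t%:Z - m%:Z | t <- iota 0 (2 * m).+1]) //.
- rewrite big_map (eq_bigl xpredT) => [|t]; last by rewrite in_setT.
  rewrite -(big_mkord xpredT (fun t => fine 'E_L[site_monomial s t])).
  rewrite /index_iota subn0; apply: eq_bigr => t _.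
  by rewrite /loop_factor !upE -down_steps_loop // /site_monomial sm.
- by rewrite map_inj_uniq ?iota_uniq // => a b; lia.
- move=> i _; rewrite /loop_factor !upE -down_steps_loop // => /negP iS.
  have far : (size s <= `|(i - 0)%R|)%N.
    by rewrite leqNgt; apply: contra_notN iS; rewrite sm; exact: sites.
  transitivity (fine 'E_L[cst 1 : R -> R]); last by rewrite expectation_cst.
  congr (fine 'E_L[_]); apply/funext => x.
  by rewrite up_steps_far // down_steps_far // !expr0 mulr1.
Qed.

(** Every step changes the parity of the position. *)
Lemma walk_end_parity z s : exists k : int, walk_end z s = z + (size s)%:Z + 2 * k.
Proof.
elim: s z => [|b s IHs] z; first by exists 0; rewrite /walk_end /=; lia.
have [k E] := IHs (walk_step z b); rewrite /walk_end /= -/(walk_end _ _) E.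
by exists (if b then k else k - 1); case: b {E}; rewrite /walk_step; lia.
Qed.

Lemma loop_moment_odd (R : realType) (L : probability R R) m :
  odd m -> loop_moment L m = 0.
Proof.
move=> om; rewrite /loop_moment big_seq_cond big_pred0 // => s.
rewrite mem_step_sequences; apply/negP => /andP[/eqP sm /eqP s0].
have [k] := walk_end_parity 0 s; rewrite s0 sm; lia.
Qed.

(** * Bounded measurable functions *)

Section bounded_measurable.
Context {d} {T : measurableType d} {R : realType}.
Implicit Types f g : T -> R.

(** The class of functions in which all integrands of the probabilistic part live:
    it is stable under the algebraic operations, and its members are integrable for
    every probability measure. *)
Definition bounded_measurable f :=
  measurable_fun setT f /\ exists M, forall x, `|f x| <= M.

Lemma bounded_measurable_itv f a b : measurable_fun setT f ->
  (forall x, a <= f x <= b) -> bounded_measurable f.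
Proof.
move=> mf fab; split=> //; exists (`|a| + `|b|) => x.
have /andP[fa fb] := fab x; rewrite ler_norml.
have := ler_norm b; have := lerNnormlW (lexx `|a|).
by have := normr_ge0 a; have := normr_ge0 b; lra.
Qed.

Lemma bounded_measurable_cst c : bounded_measurable (fun=> c).
Proof. by split; [exact: measurable_cst | exists `|c|]. Qed.

Lemma bounded_measurableD f g :
  bounded_measurable f -> bounded_measurable g -> bounded_measurable (fun x => f x + g x).
Proof.
move=> [mf [M fM]] [mg [N gN]]; split; first exact: measurable_funD.
by exists (M + N) => x; rewrite (le_trans (ler_normD _ _)) // lerD.
Qed.

Lemma bounded_measurableM f g :
  bounded_measurable f -> bounded_measurable g -> bounded_measurable (fun x => f x * g x).
Proof.
move=> [mf [M fM]] [mg [N gN]]; split; first exact: measurable_funM.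
by exists (M * N) => x; rewrite normrM ler_pM.
Qed.

Lemma bounded_measurableB f g :
  bounded_measurable f -> bounded_measurable g -> bounded_measurable (fun x => f x - g x).
Proof.
move=> bf bg; rewrite (_ : (fun _ => _) = (fun x => f x + -1 * g x)).
  exact/bounded_measurableD/bounded_measurableM/bg/bounded_measurable_cst.
by apply/funext => x; rewrite mulN1r.
Qed.

Lemma bounded_measurable_norm f :
  bounded_measurable f -> bounded_measurable (fun x => `|f x|).
Proof.
move=> [mf [M fM]]; split; first exact: measurableT_comp.
by exists M => x; rewrite normr_id.
Qed.

Lemma bounded_measurable_sum (I : Type) (s : seq I) (p : pred I) (F : I -> T -> R) :
  (forall i, bounded_measurable (F i)) ->
  bounded_measurable (fun x => \sum_(i <- s | p i) F i x).
Proof.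
move=> bF; elim: s => [|i s IHs].
  by under eq_fun do rewrite big_nil; exact: bounded_measurable_cst.
under eq_fun do rewrite big_cons; case: (p i) => //.
exact: bounded_measurableD.
Qed.

Lemma bounded_measurable_prod (I : Type) (s : seq I) (F : I -> T -> R) :
  (forall i, bounded_measurable (F i)) ->
  bounded_measurable (fun x => \prod_(i <- s) F i x).
Proof.
move=> bF; elim: s => [|i s IHs].
  by under eq_fun do rewrite big_nil; exact: bounded_measurable_cst.
by under eq_fun do rewrite big_cons; exact: bounded_measurableM.
Qed.

Lemma bounded_measurable_indic (A : set T) : measurable A ->
  bounded_measurable (\1_A : T -> R).
Proof.
move=> mA; apply: (@bounded_measurable_itv _ 0 1) => [|x]; first exact: measurable_indic.
by rewrite indicE; case: (_ \in _); rewrite ?ler01 lexx.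
Qed.

Lemma bounded_measurable_integrable (P : probability T R) f :
  bounded_measurable f -> P.-integrable setT (EFin \o f).
Proof.
move=> [mf [M fM]]; apply: measurable_bounded_integrable => //.
  by rewrite /= probability_setT ltry.
exists M; split; first by rewrite num_real.
by move=> N MN x _; apply: le_trans (fM x) _; exact: ltW.
Qed.

Lemma Rintegral_sum (P : probability T R) (I : Type) (s : seq I) (F : I -> T -> R) :
  (forall i, bounded_measurable (F i)) ->
  (\int[P]_x (\sum_(i <- s) F i x) = \sum_(i <- s) \int[P]_x F i x)%R.
Proof.
move=> bF; elim: s => [|i s IHs].
  under eq_Rintegral do rewrite big_nil.
  by rewrite Rintegral_cst // mul0r big_nil.
under eq_Rintegral do rewrite big_cons.
rewrite RintegralD // ?IHs ?big_cons //; apply: bounded_measurable_integrable => //.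
exact: bounded_measurable_sum.
Qed.

Lemma Rintegral_bound (P : probability T R) f M :
  bounded_measurable f -> (forall x, `|f x| <= M) -> `|\int[P]_x f x| <= M.
Proof.
move=> bf fM; have iM : \int[P]_x M = M by rewrite Rintegral_cst //= probability_setT mulr1.
apply: le_trans (le_normr_Rintegral measurableT (bounded_measurable_integrable P bf)) _.
rewrite -[leRHS]iM; apply: le_Rintegral => //; apply: bounded_measurable_integrable.
  exact: bounded_measurable_norm.
exact: bounded_measurable_cst.
Qed.

End bounded_measurable.

Lemma bounded_measurable_comp d d' (T : measurableType d) (T' : measurableType d')
    (R : realType) (h : T' -> T) (f : T -> R) :
  measurable_fun setT h -> bounded_measurable f -> bounded_measurable (f \o h).
Proof.
by move=> mh [mf [M fM]]; split; [exact: measurableT_comp | exists M => x /=].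
Qed.

(** The sum counts the multiples of 1 / (N + 1) below y: a function with values in
    [0, 1] is a uniform limit of combinations of indicators of its upper level sets. *)
Lemma staircase (R : realType) (y : R) N : 0 <= y <= 1 ->
  `|y - \sum_(k < N.+1) N.+1%:R^-1 * (k.+1%:R / N.+1%:R <= y)%R%:R| <= N.+1%:R^-1.
Proof.
move=> /andP[y0 y1].
have N0 : 0 < N.+1%:R :> R by rewrite ltr0n.
have Ny0 : 0 <= N.+1%:R * y by rewrite mulr_ge0 // ltW.
set m := Num.truncn (N.+1%:R * y).
have /andP[m1 m2] : m%:R <= N.+1%:R * y < m.+1%:R by rewrite /m truncn_itv.
have mN : (m <= N.+1)%N.
  by rewrite -(ler_nat R) (le_trans m1) // ler_piMr // ltW.
rewrite -mulr_sumr (_ : \sum_(k < _) _ = m%:R).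
  have -> : y - N.+1%:R^-1 * m%:R = N.+1%:R^-1 * (N.+1%:R * y - m%:R).
    by rewrite mulrBr mulKf // gt_eqF.
  rewrite normrM gtr0_norm ?invr_gt0 // ler_piMr ?invr_ge0 ?ltW //.
  by rewrite ger0_norm ?subr_ge0 //; move: m2; rewrite -natr1; lra.
rewrite -natr_sum; congr _%:R; transitivity (\sum_(k < N.+1 | (k < m)%N) 1)%N.
  rewrite [RHS]big_mkcond; apply: eq_bigr => k _.
  rewrite ler_pdivrMr // mulrC -truncn_ge_nat // -/m.
by rewrite -(big_ord_widen _ (fun=> 1%N) mN) sum1_card card_ord.
Qed.

(** * Products of independent variables *)

Lemma Rintegral_indic d (T : measurableType d) (R : realType)
  (P : probability T R) (A : set T) : measurable A ->
  \int[P]_x \1_A x = fine (P A).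
Proof. by move=> mA; rewrite /Rintegral integral_indic // setIT. Qed.

(** A factorisation known for indicators of sets extends to functions with values
    in [0, 1], because these are uniform limits of staircase functions. *)
Lemma Rintegral_product_law d (T : measurableType d) (R : realType)
    (P : probability T R) (L : probability R R) (X : T -> R) (H : T -> R) (c : R)
    (phi : R -> R) :
  measurable_fun setT X -> bounded_measurable H ->
  (forall B, measurable B -> \int[P]_w (H w * \1_B (X w)) = c * fine (L B)) ->
  measurable_fun setT phi -> (forall x, 0 <= phi x <= 1) ->
  \int[P]_w (H w * phi (X w)) = c * \int[L]_x phi x.
Proof.
move=> mX bH HB mphi phi01; have [M HM] := bH.2.
have bphi : bounded_measurable phi by exact: (@bounded_measurable_itv _ _ _ _ 0 1).
have bcomp (f : R -> R) : bounded_measurable f -> bounded_measurable (fun w => f (X w)).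
  by move=> bf; exact: (bounded_measurable_comp mX bf).
pose B N k : set R := [set x | k.+1%:R / N.+1%:R <= phi x].
have mB N k : measurable (B N k).
  rewrite (_ : B N k = phi @^-1` `[k.+1%:R / N.+1%:R, +oo[).
    by rewrite -[X in measurable X]setTI; exact: mphi.
  by apply/seteqP; split=> x /=; rewrite in_itv /= andbT.
have indB N k x : \1_(B N k) x = (k.+1%:R / N.+1%:R <= phi x)%R%:R :> R.
  by rewrite indicE (_ : (x \in B N k) = (k.+1%:R / N.+1%:R <= phi x)) //;
    apply/idP/idP; rewrite inE.
pose g N (x : R) : R := \sum_(k < N.+1) N.+1%:R^-1 * \1_(B N k) x.
have gE N x : `|phi x - g N x| <= N.+1%:R^-1.
  by rewrite /g; under eq_bigr do rewrite indB; exact: staircase.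
have bind N k : bounded_measurable (\1_(B N k) : R -> R).
  exact: bounded_measurable_indic.
have bterm N k : bounded_measurable (fun x : R => N.+1%:R^-1 * \1_(B N k) x : R).
  by apply: bounded_measurableM (bind N k); exact: bounded_measurable_cst.
have bg N : bounded_measurable (g N) by exact: bounded_measurable_sum.
have gPL N : \int[P]_w (H w * g N (X w)) = c * \int[L]_x g N x.
  transitivity (\int[P]_w (\sum_(k < N.+1) N.+1%:R^-1 * (H w * \1_(B N k) (X w)))).
    apply: eq_Rintegral => w _; rewrite /g mulr_sumr; apply: eq_bigr => k _.
    by rewrite mulrCA.
  rewrite !Rintegral_sum // => [|k]; last first.
    apply: bounded_measurableM; first exact: bounded_measurable_cst.
    by apply: bounded_measurableM => //; exact: bcomp.
  rewrite mulr_sumr; apply: eq_bigr => k _.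
  rewrite !RintegralZl //; last 2 first.
  - exact: bounded_measurable_integrable.
  - apply: bounded_measurable_integrable.
    by apply: bounded_measurableM => //; exact: bcomp.
  by rewrite HB // Rintegral_indic // mulrCA.
have int0 d' (T' : measurableType d') (P' : probability T' R) (f h : T' -> R) :
    bounded_measurable f -> bounded_measurable h ->
    \int[P']_x f x - \int[P']_x h x = \int[P']_x (f x - h x).
  by move=> bf bh; rewrite RintegralB //; exact: bounded_measurable_integrable.
have close N : `|\int[P]_w (H w * phi (X w)) - c * \int[L]_x phi x|
    <= (M + `|c|) * N.+1%:R^-1.
  have -> : \int[P]_w (H w * phi (X w)) - c * \int[L]_x phi x =
      (\int[P]_w (H w * phi (X w)) - \int[P]_w (H w * g N (X w)))
      - c * (\int[L]_x phi x - \int[L]_x g N x) by rewrite gPL; ring.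
  rewrite !int0 //; try by apply: bounded_measurableM => //; exact: bcomp.
  rewrite mulrDl; apply: le_trans (ler_normB _ _) _; apply: lerD.
    apply: Rintegral_bound => [|w].
      by apply: bounded_measurableB; apply: bounded_measurableM => //; exact: bcomp.
    by rewrite -mulrBr normrM ler_pM.
  rewrite normrM ler_wpM2l // Rintegral_bound //.
  exact: bounded_measurableB.
apply/eqP; rewrite -subr_eq0 -normr_le0; apply/ler_addgt0Pr => e e0; rewrite add0r.
pose N := Num.truncn ((M + `|c|) / e).
apply: le_trans (close N) _; rewrite ler_pdivrMr ?ltr0n //.
rewrite mulrC -ler_pdivrMr //; exact/ltW/truncnS_gt.
Qed.

Section independent_products.
Context {d} {T : measurableType d} {R : realType}.
Variables (P : probability T R) (L : probability R R).
Variables (I : set nat) (X : nat -> {RV P >-> R}).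
Hypothesis X_iid : iid I X L.
Variable phi : nat -> R -> R.
Hypothesis mphi : forall i, measurable_fun setT (phi i).
Hypothesis phi01 : forall i x, 0 <= phi i x <= 1.

Let bX (f : R -> R) i : bounded_measurable f -> bounded_measurable (fun w => f (X i w)).
Proof. by move=> bf; exact: (bounded_measurable_comp (measurable_funPT (X i)) bf). Qed.

Let bphi i : bounded_measurable (phi i).
Proof. exact: (@bounded_measurable_itv _ _ _ _ 0 1). Qed.

Lemma independent_indicators (J : seq nat) (A : nat -> set R) :
  uniq J -> (forall i, i \in J -> I i) -> (forall i, measurable (A i)) ->
  \int[P]_w \prod_(i <- J) \1_(A i) (X i w) = \prod_(i <- J) fine (L (A i)).
Proof.
move=> uJ JI mA; have [ind law] := X_iid.
pose F : {fset nat} := [fset i | i in J]%fset.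
have FI : [set` F] `<=` I by move=> i /=; rewrite inE /= => /JI.
have mE i : measurable (X i @^-1` A i).
  by rewrite -[X in measurable X]setTI; exact: measurable_funPT.
have permFJ : perm_eq (enum_fset F) J.
  by apply: uniq_perm => // i; rewrite inE.
transitivity (\int[P]_w \1_(\bigcap_(i in [set` F]) (X i @^-1` A i)) w).
  apply: eq_Rintegral => w _; rewrite -(perm_big _ permFJ) /=.
  rewrite indicE; have [wA|wA] := boolP (w \in _).
    rewrite big_seq big1 // => i iF; rewrite indicE mem_set //.
    by move/set_mem: wA; exact.
  have {}wA : ~ (\bigcap_(i in [set` F]) (X i @^-1` A i)) w.
    by move/mem_set; exact/negP.
  have [i iF wAi] : exists2 i, i \in F & ~ A i (X i w).
    by apply: contrapT => h; apply: wA => i iF; apply: contrapT => ?; apply: h; exists i.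
  rewrite (bigD1_seq i) //= indicE memNset ?mul0r //.
rewrite Rintegral_indic; last by apply: fin_bigcap_measurable.
have := ind F A FI mA; rewrite big_seq => ->.
under eq_bigr => i iF do rewrite [P _](law i (FI i iF) (A i) (mA i)).
rewrite -big_seq (perm_big _ permFJ) /=.
elim: J {uJ JI F FI permFJ} => [|i J IHJ]; first by rewrite !big_nil.
rewrite !big_cons fineM ?IHJ // ?fin_num_measure //.
by apply/prode_fin_num => *; exact: fin_num_measure.
Qed.

(** Induction on J: one indicator at a time is replaced by a function. The statement
    keeps indicators for the indices J' still to come, which is what the extension
    from indicators to functions consumes. *)
Lemma independent_prod_indicators (J J' : seq nat) (A : nat -> set R) :
  uniq (J ++ J') -> (forall i, i \in J ++ J' -> I i) ->
  (forall i, measurable (A i)) ->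
  \int[P]_w (\prod_(i <- J) phi i (X i w) * \prod_(i <- J') \1_(A i) (X i w)) =
  \prod_(i <- J) (\int[L]_x phi i x) * \prod_(i <- J') fine (L (A i)).
Proof.
elim: J J' A => [|j J IHJ] J' A uJ JI mA.
  rewrite big_nil mul1r -independent_indicators //.
  by apply: eq_Rintegral => w _; rewrite big_nil mul1r.
have jJJ' : j \notin J ++ J' by case/andP: uJ.
have bind i : bounded_measurable (\1_(A i) : R -> R).
  exact: bounded_measurable_indic.
pose H w := \prod_(i <- J) phi i (X i w) * \prod_(i <- J') \1_(A i) (X i w) : R.
transitivity (\int[P]_w (H w * phi j (X j w))).
  by apply: eq_Rintegral => w _; rewrite big_cons /H; ring.
rewrite (@Rintegral_product_law _ _ _ P L (X j) H
  (\prod_(i <- J) (\int[L]_x phi i x) * \prod_(i <- J') fine (L (A i)))) //.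
- by rewrite big_cons; ring.
- apply: bounded_measurableM; apply: bounded_measurable_prod => i; exact: bX.
move=> B mB; pose A' i := if i == j then B else A i.
have mA' i : measurable (A' i) by rewrite /A'; case: eqP.
have A'E i : i \in J' -> A' i = A i.
  by rewrite /A'; case: eqP => // ->; move: jJJ'; rewrite mem_cat => /norP[_ /negP].
have prodA' (f : set R -> nat -> R) :
    \prod_(i <- J') f (A' i) i = \prod_(i <- J') f (A i) i.
  by apply: eq_big_seq => i iJ'; rewrite A'E.
have pj : perm_eq (J ++ j :: J') (j :: J ++ J') by rewrite (perm_catCA J [:: j] J').
have := IHJ (j :: J') A' _ _ mA'.
rewrite !big_cons {2}/A' eqxx => E.
transitivity (\prod_(i <- J) (\int[L]_x phi i x) *
    (fine (L B) * \prod_(j <- J') fine (L (A' j)))).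
  rewrite -E; last 2 first.
  - by rewrite (perm_uniq pj).
  - by move=> i; rewrite (perm_mem pj); exact: JI.
  apply: eq_Rintegral => w _; rewrite big_cons {1}/A' eqxx /H.
  by rewrite (prodA' (fun S i => \1_S (X i w))); ring.
by rewrite (prodA' (fun S _ => fine (L S))); ring.
Qed.

Lemma independent_prod (J : seq nat) :
  uniq J -> (forall i, i \in J -> I i) ->
  \int[P]_w \prod_(i <- J) phi i (X i w) = \prod_(i <- J) \int[L]_x phi i x.
Proof.
move=> uJ JI; have := @independent_prod_indicators J [::] (fun=> set0).
rewrite cats0 big_nil mulr1 => <- //.
by apply: eq_Rintegral => w _; rewrite big_nil mulr1.
Qed.

End independent_products.

(** * A law of large numbers for windows *)

(** Convergence of the averages along the squares suffices for bounded sequences: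
    consecutive squares below and above n differ by a multiple of the square root of
    n, which is negligible with respect to n. *)
Lemma cesaro_interpolate (R : realType) (a : nat -> R) (c : R) :
  (forall i, `|a i - c| <= 1) ->
  (\sum_(0 <= i < n.+1 ^ 2) (a i - c)) / (n.+1 ^ 2)%:R @[n --> \oo] --> (0 : R) ->
  (\sum_(0 <= i < n) a i) / n%:R @[n --> \oo] --> c.
Proof.
move=> ac1 sq; apply/cvgrPdist_le => e e0.
pose S n := \sum_(0 <= i < n) (a i - c).
have S_le m n : (m <= n)%N -> `|S n - S m| <= (n - m)%:R.
  move=> mn; rewrite /S (@big_cat_nat _ _ _ m 0 n) //= addrAC subrr add0r.
  apply: le_trans (ler_norm_sum _ _ _) _.
  by rewrite -sumr_const_nat; apply: ler_sum => i _; exact: ac1.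
move/cvgrPdist_le : sq => /(_ (e / 2)); rewrite divr_gt0 // => /(_ isT) [M _ MS].
(* Beyond 8 / e the gap between consecutive squares is at most half of e times n. *)
pose M' := maxn M (Num.truncn (8 / e)).+1.
near=> n.
have nM : (M'.+1 ^ 2 <= n)%N by near: n; exact: nbhs_infty_ge.
have [N /andP[Nn nN]] : exists N, (N.+1 ^ 2 <= n < N.+2 ^ 2)%N.
  have ex : exists N, (N.+1 ^ 2 <= n)%N by exists M'.
  have bd N : (N.+1 ^ 2 <= n)%N -> (N <= n)%N.
    by move=> h; rewrite (leq_trans _ h) // expnS expn1; nia.
  case: (ex_maxnP ex bd) => N h1 h2; exists N; rewrite h1 /= ltnNge.
  by apply/negP => /h2; rewrite ltnn.
have MN : (M' <= N)%N.
  have : (M'.+1 ^ 2 < N.+2 ^ 2)%N by exact: leq_ltn_trans nN.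
  by rewrite ltn_sqr.
have n0 : (0 < n)%N by apply: leq_trans nM; rewrite expn_gt0.
have nR0 : 0 < n%:R :> R by rewrite ltr0n.
have -> : c - (\sum_(0 <= i < n) a i) / n%:R = - (S n / n%:R).
  rewrite /S sumrB sumr_const_nat subn0 -(mulr_natr c n); by field; rewrite gt_eqF.
rewrite normrN normrM normfV (gtr0_norm nR0) ler_pdivrMr //.
have -> : S n = S (N.+1 ^ 2)%N + (S n - S (N.+1 ^ 2)%N) by ring.
apply: le_trans (ler_normD _ _) _.
have SN : `|S (N.+1 ^ 2)%N| <= e / 2 * (N.+1 ^ 2)%:R.
  have := MS N (leq_trans (leq_maxl _ _) MN).
  rewrite /= sub0r normrN normrM normfV (@gtr0_norm _ (N.+1 ^ 2)%:R) ?ltr0n ?expn_gt0 //.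
  by rewrite ler_pdivrMr ?ltr0n ?expn_gt0.
have dn : ((n - N.+1 ^ 2)%:R : R) <= e / 2 * (N.+1 ^ 2)%:R.
  apply: le_trans (_ : (4 * N.+1)%:R <= _); first by rewrite ler_nat; nia.
  have : 8 / e <= N.+1%:R.
    apply: ltW; apply: lt_le_trans (truncnS_gt _) _; rewrite ler_nat.
    by rewrite (leq_trans _ (leqW MN)) // leq_maxr.
  rewrite ler_pdivrMr // => h; rewrite natrX natrM.
  have : 0 < N.+1%:R :> R by rewrite ltr0n.
  by move: h; move: (N.+1%:R) => x; nra.
have := S_le _ _ Nn.
have : (N.+1 ^ 2)%:R <= n%:R :> R by rewrite ler_nat.
move: SN dn; move: (`|_|) (`|_|) ((N.+1 ^ 2)%:R) ((n - _)%:R) n%:R => s1 s2 q k r.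
by nra.
Unshelve. all: by end_near. Qed.

(** By monotone convergence the sum of the series is integrable, hence finite almost
    everywhere, and the terms of a convergent series tend to 0. *)
Lemma ae_cvg0_summable d (T : measurableType d) (R : realType)
    (P : probability T R) (A : nat -> T -> R) (B : R) :
  (forall n, bounded_measurable (A n)) -> (forall n w, 0 <= A n w) ->
  (forall N, \sum_(0 <= n < N) \int[P]_w A n w <= B) ->
  {ae P, forall w, A n w @[n --> \oo] --> (0 : R)}.
Proof.
move=> bA A0 AB.
pose f w := (\sum_(n <oo) (A n w)%:E)%E.
have mA n : measurable_fun setT (fun w => (A n w)%:E).
  by apply/measurable_EFinP; case: (bA n).
have A0' n w : (0 <= (A n w)%:E)%E by rewrite lee_fin.
have mf : measurable_fun setT f by apply: ge0_emeasurable_sum.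
have intA n : (\int[P]_w (A n w)%:E = (\int[P]_w A n w)%:E)%E.
  rewrite /Rintegral fineK //; apply: integrable_fin_num => //.
  exact: (bounded_measurable_integrable P (bA n)).
have intf : (\int[P]_w f w <= B%:E)%E.
  rewrite integral_nneseries //; apply: lime_le.
    by apply: is_cvg_nneseries => n _ _; exact: integral_ge0.
  apply: nearW => N; under eq_bigr do rewrite intA.
  by rewrite sumEFin lee_fin.
have If : P.-integrable setT f.
  apply/integrableP; split => //; apply: le_lt_trans (ltry B).
  apply: le_trans intf; apply: ge0_le_integral => //.
  - exact: measurableT_comp.
  - by move=> w _; rewrite gee0_abs //; apply: nneseries_ge0.
have := integrable_ae measurableT If; apply: filterS => w /(_ I) fw.
have tail : (\sum_(N <= n <oo) (A n w)%:E)%E @[N --> \oo] --> 0%E.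
  apply: nneseries_tail_cvg => //.
  by move: fw; rewrite fin_numElt => /andP[].
have : (A n w)%:E @[n --> \oo] --> 0%E.
  apply: (squeeze_cvge _ (cvg_cst _) tail); apply: nearW => n.
  rewrite lee_fin A0 /=; have := @nneseries_lim_ge R (fun n => (A n w)%:E) xpredT n n.+1.
  by rewrite big_nat1; apply.
by move/fine_cvg.
Qed.

Lemma sum_near_diagonal (n r i : nat) :
  (\sum_(j < n) ((i < j + r) && (j < i + r)) <= 2 * r)%N.
Proof.
rewrite -(big_mkord xpredT (fun j => nat_of_bool ((i < j + r) && (j < i + r))%N)).
rewrite /index_iota subn0 -[leqRHS](size_iota (i - r)).
have -> : (\sum_(j <- iota 0 n) ((i < j + r) && (j < i + r)) =
    size [seq j <- iota 0 n | (i < j + r) && (j < i + r)])%N.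
  by rewrite size_filter -sumn_count sumnE big_map.
apply: uniq_leq_size => [|j]; first by rewrite filter_uniq // iota_uniq.
by rewrite mem_filter !mem_iota; lia.
Qed.

Lemma sum_inverse_squares_le2 (R : realFieldType) N :
  \sum_(0 <= n < N) ((n.+1 ^ 2)%:R)^-1 <= 2 :> R.
Proof.
case: N => [|N]; first by rewrite big_geq.
suff : \sum_(0 <= n < N.+1) ((n.+1 ^ 2)%:R)^-1 <= 2 - N.+1%:R^-1 :> R.
  by move/le_trans; apply; rewrite gerBl invr_ge0.
elim: N => [|N IHN]; first by rewrite big_nat1 /= exp1n invr1; lra.
rewrite big_nat_recr //=; apply: le_trans (lerD IHN (lexx _)) _.
rewrite natrX -[N.+2%:R]natr1; set x : R := N.+1%:R.
have x0 : 0 < x by rewrite ltr0n.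
have -> : 2 - x^-1 + (x + 1) ^- 2 = 2 - (x + 1)^-1 - (x * (x + 1) ^+ 2)^-1.
  by field; rewrite gt_eqF ?gt_eqF //; lra.
by rewrite gerBl invr_ge0 mulr_ge0 ?exprn_ge0 //; lra.
Qed.

(** Terms at distance at least r are uncorrelated, so the centred sum of n terms has
    second moment at most 2 r n. Divided by n^2 this is summable along the squares. *)
Lemma bounded_lln d (T : measurableType d) (R : realType) (P : probability T R)
    (Y : nat -> T -> R) (c : R) (r : nat) :
  (forall n, measurable_fun setT (Y n)) -> (forall n w, 0 <= Y n w <= 1) ->
  0 <= c <= 1 -> (forall n, \int[P]_w Y n w = c) ->
  (forall i j, (i + r <= j)%N -> \int[P]_w (Y i w * Y j w) = c * c) ->
  {ae P, forall w, (\sum_(0 <= i < n) Y i w) / n%:R @[n --> \oo] --> c}.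
Proof.
move=> mY Y01 c01 Yc Ycc.
have bY n : bounded_measurable (Y n) by apply: (@bounded_measurable_itv _ _ _ _ 0 1).
pose U n w := Y n w - c.
have bU n : bounded_measurable (U n).
  by apply: bounded_measurableB => //; exact: bounded_measurable_cst.
have U1 n w : `|U n w| <= 1.
  by rewrite /U ler_norml; have := Y01 n w; lra.
have bUU i j : bounded_measurable (fun w => U i w * U j w) by exact: bounded_measurableM.
have covU i j : \int[P]_w (U i w * U j w) <= ((i < j + r) && (j < i + r))%N%:R.
  have UU1 : `|\int[P]_w (U i w * U j w)| <= 1.
    by apply: Rintegral_bound => // w; rewrite normrM mulr_ile1.
  have far a b : (a + r <= b)%N -> \int[P]_w (U a w * U b w) = 0.
    move=> ab.
    transitivity (\int[P]_w (Y a w * Y b w - c * (Y a w + Y b w - c))).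
      by apply: eq_Rintegral => w _; rewrite /U; ring.
    have int f : bounded_measurable f -> P.-integrable setT (EFin \o f).
      exact: bounded_measurable_integrable.
    have bc := @bounded_measurable_cst _ T R c.
    have bs : bounded_measurable (fun w => Y a w + Y b w) by exact: bounded_measurableD.
    have bsc := bounded_measurableB bs bc.
    have bcs := bounded_measurableM bc bsc.
    have bYY := bounded_measurableM (bY a) (bY b).
    rewrite RintegralB ?RintegralZl ?RintegralB ?RintegralD ?Rintegral_cst //=;
      try exact: int.
    by rewrite probability_setT /= Ycc // !Yc; ring.
  have sym : \int[P]_w (U i w * U j w) = \int[P]_w (U j w * U i w).
    by apply: eq_Rintegral => w _; rewrite mulrC.
  case: ltnP => [ij|ji] /=; last by rewrite sym far.
  by case: ltnP => [ji|{}ij] /=; [apply: le_trans UU1; exact: ler_norm | rewrite far].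
pose S n w := \sum_(0 <= i < n) U i w.
have varS n : \int[P]_w (S n w ^+ 2) <= (n * (2 * r))%:R.
  have -> : \int[P]_w (S n w ^+ 2) =
      \int[P]_w (\sum_(i < n) \sum_(j < n) (U i w * U j w)).
    apply: eq_Rintegral => w _; rewrite /S !big_mkord expr2 mulr_suml.
    by apply: eq_bigr => i _; rewrite mulr_sumr.
  rewrite Rintegral_sum => [|i]; last exact: bounded_measurable_sum.
  apply: le_trans (_ : \sum_(i < n) (2 * r)%:R <= _); last first.
    by rewrite sumr_const card_ord -[leLHS]mulr_natr -natrM mulnC.
  apply: ler_sum => i _; rewrite Rintegral_sum //.
  apply: le_trans (_ : (\sum_(j < n) ((i < j + r) && (j < i + r)))%N%:R <= _).
    by rewrite natr_sum; exact: ler_sum.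
  by rewrite ler_nat sum_near_diagonal.
pose A n w := (S (n.+1 ^ 2)%N w / (n.+1 ^ 2)%:R) ^+ 2.
have bS n : bounded_measurable (S n) by exact: bounded_measurable_sum.
have bS2 n : bounded_measurable (fun w => S n w ^+ 2).
  by under eq_fun do rewrite expr2; exact: bounded_measurableM.
have bA n : bounded_measurable (A n).
  rewrite /A; under eq_fun do rewrite exprMn.
  by apply: bounded_measurableM => //; exact: bounded_measurable_cst.
have intA n : \int[P]_w A n w <= (2 * r)%:R * ((n.+1 ^ 2)%:R)^-1.
  under eq_Rintegral do rewrite /A exprMn.
  rewrite RintegralZr //; last exact: bounded_measurable_integrable.
  apply: le_trans (ler_wpM2r _ (varS _)) _; first by rewrite exprn_ge0 // invr_ge0.
  rewrite natrM expr2 le_eqVlt; apply/orP; left; apply/eqP.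
  have : (n.+1 ^ 2)%:R != 0 :> R by rewrite pnatr_eq0 expn_eq0.
  by move: ((n.+1 ^ 2)%:R) => q q0; field.
have sumA N : \sum_(0 <= n < N) \int[P]_w A n w <= (2 * r)%:R * 2.
  apply: le_trans (ler_sum _ (fun n _ => intA n)) _.
  by rewrite -mulr_sumr ler_wpM2l // sum_inverse_squares_le2.
have A0 n w : 0 <= A n w by exact: sqr_ge0.
have := ae_cvg0_summable bA A0 sumA; apply: filterS => w Aw.
apply: cesaro_interpolate => [i|]; first exact: U1.
apply/cvgrPdist_le => e e0; move/cvgrPdist_le : Aw => /(_ (e ^+ 2)).
rewrite exprn_gt0 // => /(_ isT); apply: filterS => n /=.
by rewrite !sub0r !normrN ger0_norm // /A -real_normK ?num_real // ler_sqr ?nnegrE // ltW.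
Qed.

(** Two windows of length r at distance at least r use disjoint sets of indices, so
    their products are uncorrelated. *)
Lemma window_lln d (T : measurableType d) (R : realType) (P : probability T R)
    (L : probability R R) (X : nat -> {RV P >-> R}) (m r : nat)
    (phi : nat -> R -> R) :
  iid [set i | (m <= i)%N] X L ->
  (forall t, measurable_fun setT (phi t)) -> (forall t x, 0 <= phi t x <= 1) ->
  {ae P, forall w,
    (\sum_(0 <= j < n) \prod_(t < r) phi t (X (j + m + t)%N w)) / n%:R @[n --> \oo]
    --> \prod_(t < r) \int[L]_x phi t x}.
Proof.
move=> X_iid mphi phi01.
have bphi t : bounded_measurable (phi t) by exact: (@bounded_measurable_itv _ _ _ _ 0 1).
pose Y j w := \prod_(t < r) phi t (X (j + m + t)%N w).
set c := \prod_(t < r) _.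
have mY j : measurable_fun setT (Y j).
  suff : bounded_measurable (Y j) by case.
  apply: bounded_measurable_prod => t.
  exact: (bounded_measurable_comp (measurable_funPT (X _)) (bphi t)).
have phiI t : 0 <= \int[L]_x phi t x <= 1.
  rewrite Rintegral_ge0 /= => [|x _]; last by have /andP[] := phi01 t x.
  apply: le_trans (ler_norm _) _; apply: Rintegral_bound => // x.
  by have /andP[p0 p1] := phi01 t x; rewrite ger0_norm.
have itv_prod (F : 'I_r -> R) : (forall t, 0 <= F t <= 1) -> 0 <= \prod_t F t <= 1.
  move=> F01; rewrite prodr_ge0 => [|t _]; last by have /andP[] := F01 t.
  exact: numdomain.Num.Theory.prodr_ile1.
have iotaE (F : nat -> R) a : \prod_(i <- iota a r) F i = \prod_(t < r) F (a + t)%N.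
  rewrite -(big_mkord xpredT (fun t => F (a + t)%N)) /index_iota subn0.
  by rewrite -{1}[a]addn0 iotaDl big_map.
have window (f : nat -> R) a : \prod_(t < r) f t = \prod_(i <- iota a r) f (i - a)%N.
  by rewrite iotaE; apply: eq_bigr => t _; rewrite addKn.
have windowX (phi' : nat -> R -> R) a w : (forall t, (t < r)%N -> phi' (a + t)%N =1 phi t) ->
    \prod_(t < r) phi t (X (a + t)%N w) = \prod_(i <- iota a r) phi' i (X i w).
  by move=> phi'E; rewrite iotaE; apply: eq_bigr => t _; rewrite phi'E.
apply: (@bounded_lln _ T R P Y c r) => // [n w|||i j ij].
- by apply: itv_prod.
- by apply: itv_prod.
- move=> n; pose phi' i := phi (i - (n + m))%N.
  have phi'E t : (t < r)%N -> phi' (n + m + t)%N =1 phi t by move=> _ x; rewrite /phi' addKn.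
  under eq_Rintegral do rewrite /Y (windowX phi') //.
  rewrite (@independent_prod _ T R P L _ X X_iid phi') ?iota_uniq.
  + by rewrite /c (window (fun t => \int[L]_x phi t x) (n + m)%N).
  + by move=> i; exact: mphi.
  + by move=> i; exact: phi01.
  + by [].
  + by move=> i; rewrite mem_iota /=; lia.
(* The two windows are concatenated into one family of functions indexed by the
   absolute positions, to which the product rule applies once. *)
- pose phi' k := if (k < i + m + r)%N then phi (k - (i + m))%N else phi (k - (j + m))%N.
  have phi'i t : (t < r)%N -> phi' (i + m + t)%N =1 phi t.
    by move=> tr x; rewrite /phi' ltn_add2l tr addKn.
  have phi'j t : (t < r)%N -> phi' (j + m + t)%N =1 phi t.
    by move=> tr x; rewrite /phi' ifF ?addKn //; lia.
  under eq_Rintegral do rewrite /Y (windowX phi') // (windowX phi') // -big_cat.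
  rewrite (@independent_prod _ T R P L _ X X_iid phi').
  + rewrite big_cat /= /c; congr (_ * _).
      rewrite (window (fun t => \int[L]_x phi t x) (i + m)%N); apply: eq_big_seq => k.
      by rewrite mem_iota => /andP[_ k1]; rewrite /phi' k1.
    rewrite (window (fun t => \int[L]_x phi t x) (j + m)%N); apply: eq_big_seq => k.
    by rewrite mem_iota => /andP[k1 _]; rewrite /phi' ifF //; lia.
  + by move=> t; rewrite /phi'; case: ifP.
  + by move=> t x; rewrite /phi'; case: ifP.
  + rewrite cat_uniq !iota_uniq andbT; apply/hasPn => k; rewrite !mem_iota; lia.
  + by move=> k; rewrite mem_cat !mem_iota /=; lia.
Qed.

(** * Polynomial approximation of Lipschitz functions *)

(** The n-th Bernstein polynomial of k |-> g k: its value at x is the mean of g at a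
    binomial variable with parameters n and x, and the recursion conditions on one
    trial. *)
Fixpoint bernstein (R : nzRingType) n (g : nat -> R) : {poly R} :=
  if n is n'.+1 then 'X * bernstein n' (g \o succn) + (1 - 'X) * bernstein n' g
  else (g 0%N)%:P.

(** The right-hand side is the mean of the hypothesis at a binomial variable S: the
    mean of (S - c)^2 is the variance of S plus the squared bias. Letting c vary makes
    the induction go through, since a success shifts c by one. *)
Lemma bernstein_bound (R : realFieldType) (x a alpha beta c : R) n (g : nat -> R) :
  0 <= x <= 1 ->
  (forall k, `|g k - a| <= alpha + beta * (k%:R - c) ^+ 2) ->
  `|(bernstein n g).[x] - a|
  <= alpha + beta * (n%:R * (x * (1 - x)) + (n%:R * x - c) ^+ 2).
Proof.
move=> /andP[x0 x1]; elim: n g c => [|n IHn] g c gc /=.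
  by rewrite hornerC mul0r add0r mul0r; exact: gc.
rewrite hornerD !hornerM hornerD hornerN hornerX hornerC.
have h1 := IHn (g \o succn) (c - 1) _; have h2 := IHn g c gc.
have {}h1 : `|(bernstein n (g \o succn)).[x] - a| <= alpha + beta *
     (n%:R * (x * (1 - x)) + (n%:R * x - (c - 1)) ^+ 2).
  apply: h1 => k /=; rewrite (_ : k%:R - (c - 1) = k.+1%:R - c); first exact: gc.
  by rewrite -natr1; ring.
move: h1 h2; set B1 := _.[x]; set B2 := _.[x] => h1 h2.
have -> : x * B1 + (1 - x) * B2 - a = x * (B1 - a) + (1 - x) * (B2 - a) by ring.
apply: le_trans (ler_normD _ _) _; rewrite !normrM (ger0_norm x0).
rewrite (@ger0_norm _ (1 - x)) ?subr_ge0 //.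
have y0 : 0 <= 1 - x by rewrite subr_ge0.
apply: le_trans (lerD (ler_wpM2l x0 h1) (ler_wpM2l y0 h2)) _.
by rewrite -natr1 le_eqVlt; apply/orP; left; apply/eqP; ring.
Qed.

(** The inequality C |t| <= C D + C t^2 / D puts the Lipschitz bound in the quadratic
    form that Bernstein polynomials average well; D is taken proportional to e. *)
Lemma lipschitz_poly_approx01 (R : realType) (f : R -> R) (C e : R) :
  0 < C -> 0 < e -> (forall x y, `|f x - f y| <= C * `|x - y|) ->
  exists p : {poly R}, forall x, 0 <= x <= 1 -> `|f x - p.[x]| <= e.
Proof.
move=> C0 e0 lip; pose D := e / (2 * C).
have D0 : 0 < D by rewrite divr_gt0 // mulr_gt0.
pose N := (Num.truncn (C / (D * (e / 2)))).+1.
have N0 : 0 < N%:R :> R by rewrite ltr0n.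
exists (bernstein N (fun k => f (k%:R / N%:R))) => x x01; rewrite distrC.
apply: le_trans (@bernstein_bound _ x (f x) (C * D) (C / (D * N%:R ^+ 2))
  (N%:R * x) N _ x01 _) _.
  move=> k; apply: le_trans (lip _ _) _.
  have -> : k%:R / N%:R - x = (k%:R - N%:R * x) / N%:R by field; rewrite gt_eqF.
  set t := k%:R - N%:R * x.
  rewrite normrM normfV (gtr0_norm N0) -(real_normK (num_real t)).
  move: (`|t|) (normr_ge0 t) => {}t t0; set s : R := t / N%:R.
  have -> : C * D + C / (D * N%:R ^+ 2) * t ^+ 2 = C * (D + s ^+ 2 / D).
    by rewrite /s; field; rewrite !gt_eqF.
  rewrite ler_pM2l // -(ler_pM2r D0) mulrDl divfK ?gt_eqF //.
  have sD : 0 <= s * D by apply: mulr_ge0 (ltW D0); exact: divr_ge0 (ltW N0).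
  by have := sqr_ge0 (D - s); nra.
rewrite subrr expr0n addr0.
have h : C / (D * (e / 2)) <= N%:R by exact/ltW/truncnS_gt.
move: (N%:R : R) N0 h => n n0 h.
have -> : C * D = e / 2 by rewrite /D; field; rewrite gt_eqF.
have -> : C / (D * n ^+ 2) * (n * (x * (1 - x))) = C / (D * n) * (x * (1 - x)).
  by field; rewrite !gt_eqF.
have De : 0 < D * (e / 2) by apply: mulr_gt0 => //; exact: divr_gt0.
have Dn : 0 < D * n by exact: mulr_gt0.
have Cn : C / (D * n) <= e / 2.
  rewrite ler_pdivrMr //; move: h; rewrite ler_pdivrMr //.
  by rewrite (_ : n * (D * (e / 2)) = e / 2 * (D * n)) //; ring.
have Cn0 : 0 <= C / (D * n) by exact/ltW/divr_gt0.
have /andP[x0 x1] := x01.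
by move: (C / (D * n)) Cn Cn0 => q q1 q0; nra.
Qed.

Lemma lipschitz_poly_approx (R : realType) (f : R -> R) (C e : R) :
  0 < C -> 0 < e -> (forall x y, `|f x - f y| <= C * `|x - y|) ->
  exists p : {poly R}, forall x, -1 <= x <= 1 -> `|f x - p.[x]| <= e.
Proof.
move=> C0 e0 lip.
have [||p pf] := @lipschitz_poly_approx01 R (fun x => f (2 * x - 1)) (2 * C) e _ e0.
- by rewrite mulr_gt0.
- move=> x y; apply: le_trans (lip _ _) _.
  have -> : 2 * x - 1 - (2 * y - 1) = 2 * (x - y) by ring.
  by rewrite normrM ger0_norm // mulrCA mulrA.
exists (p \Po (2^-1 *: 'X + 2^-1%:P)) => x x11.
rewrite horner_comp !hornerE.
have := pf (2^-1 * x + 2^-1); rewrite (_ : 2 * _ - 1 = x); last by field.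
by apply; lra.
Qed.

(** * Moments of measures on the segment *)

Section moments_on_segment.
Context {R : realType}.
Implicit Types (mu nu : probability R R) (f g : R -> R) (p : {poly R}).
Local Notation seg := `[(-1)%R, 1%R]%classic.

Definition moment mu (k : nat) : R := \int[mu]_(x in seg) (x ^+ k).

Lemma segment_integrable mu f M : measurable_fun setT f ->
  (forall x, -1 <= x <= 1 -> `|f x| <= M) -> mu.-integrable seg (EFin \o f).
Proof.
move=> mf fM; apply: measurable_bounded_integrable => //.
- by apply: le_lt_trans (probability_le1 mu _) _; rewrite ?ltry.
- exact: measurable_funTS.
- exists M; split; first by rewrite num_real.
  move=> N MN x; rewrite /= in_itv /= => x11; apply: le_trans (fM x x11) _; exact: ltW.
Qed.

Lemma segment_integral_bound mu f M : measurable_fun setT f -> 0 <= M ->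
  (forall x, -1 <= x <= 1 -> `|f x| <= M) -> `|\int[mu]_(x in seg) f x| <= M.
Proof.
move=> mf M0 fM; apply: le_trans (le_normr_Rintegral _ (segment_integrable mu mf fM)) _ => //.
apply: le_trans (_ : \int[mu]_(x in seg) M <= _).
  apply: le_Rintegral => //.
  - apply: (@segment_integrable _ _ M); first exact: measurableT_comp.
    by move=> x x11; rewrite normr_id fM.
  - by apply: (@segment_integrable _ _ M) => // *; rewrite ger0_norm.
rewrite Rintegral_cst // ler_piMr //.
have : (mu seg <= 1)%E by exact: probability_le1.
by rewrite -(fineK (fin_num_measure mu seg _)) // lee_fin.
Qed.

Lemma measurable_horner p : measurable_fun setT (fun x : R => p.[x]).
Proof.
elim/poly_ind: p => [|p c IHp].
  by under eq_fun do rewrite horner0; exact: measurable_cst.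
under eq_fun do rewrite hornerMXaddC.
by apply: measurable_funD => //; apply: measurable_funM.
Qed.

Lemma horner_segment_bounded p :
  exists M, forall x : R, -1 <= x <= 1 -> `|p.[x]| <= M.
Proof.
elim/poly_ind: p => [|p c [M pM]].
  by exists 0 => x _; rewrite horner0 normr0.
exists (M + `|c|) => x x11; rewrite hornerMXaddC.
apply: le_trans (ler_normD _ _) _; rewrite lerD2r normrM.
apply: le_trans (ler_wpM2l (normr_ge0 _) (_ : `|x| <= 1)) _; first by rewrite ler_norml.
by rewrite mulr1 pM.
Qed.

Lemma segment_integral_horner mu p :
  \int[mu]_(x in seg) p.[x] = \sum_(i < size p) p`_i * moment mu i.
Proof.
have bX (i : nat) : bounded_measurable ((fun x : R => x ^+ i) \_ seg).
  split; first by apply/measurable_restrict => //; exact: measurable_funTS.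
  exists 1 => x; rewrite patchE; case: ifPn => [|_]; last by rewrite normr0.
  by move=> /set_mem; rewrite /= in_itv /= => x11; rewrite normrX exprn_ile1 // ler_norml.
rewrite Rintegral_mkcond.
transitivity (\int[mu]_x (\sum_(i < size p) (p`_i * ((fun x : R => x ^+ i) \_ seg) x))).
  apply: eq_Rintegral => x _; rewrite patchE; case: ifPn => xI.
    by rewrite horner_coef; apply: eq_bigr => i _; rewrite patchE xI.
  by rewrite big1 // => i _; rewrite patchE (negPf xI) mulr0.
rewrite Rintegral_sum => [|i]; last first.
  exact: bounded_measurableM (bounded_measurable_cst _) (bX i).
apply: eq_bigr => i _; rewrite RintegralZl //; last exact: bounded_measurable_integrable.
by congr (_ * _); rewrite /moment [RHS]Rintegral_mkcond.
Qed.

(** Up to e / 4 the integrand is a polynomial, whose integral is a combination of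
    finitely many moments. Stating the Cauchy property avoids any reference to a
    limit measure, which is only constructed later. *)
Lemma cauchy_lipschitz_integral (mu_ : nat -> probability R R) (M : nat -> R) f C e :
  (forall k, moment (mu_ n) k @[n --> \oo] --> M k) ->
  0 < C -> (forall x y, `|f x - f y| <= C * `|x - y|) -> measurable_fun setT f -> 0 < e ->
  exists N, forall n m, (N <= n)%N -> (N <= m)%N ->
  `|\int[mu_ n]_(x in seg) f x - \int[mu_ m]_(x in seg) f x| <= e.
Proof.
move=> mM C0 lip mf e0; have e4 : 0 < e / 4 by rewrite divr_gt0.
have [p fp] := lipschitz_poly_approx C0 e4 lip.
have [B pB] := horner_segment_bounded p.
have fB x : -1 <= x <= 1 -> `|f x| <= B + e / 4.
  move=> x11; rewrite -[f x](subrK p.[x]) addrC.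
  by apply: le_trans (ler_normD _ _) _; apply: lerD; [exact: pB | exact: fp].
have close n : `|\int[mu_ n]_(x in seg) f x - \int[mu_ n]_(x in seg) p.[x]| <= e / 4.
  rewrite -RintegralB //; last 2 first.
  - exact: segment_integrable mf fB.
  - exact: segment_integrable (measurable_horner p) pB.
  apply: segment_integral_bound => //; last exact: ltW.
  by apply: measurable_funB => //; exact: measurable_horner.
have : \int[mu_ n]_(x in seg) p.[x] @[n --> \oo] --> \sum_(i < size p) p`_i * M i.
  under eq_fun do rewrite segment_integral_horner.
  apply: cvg_big => [|i _]; first exact: add_continuous.
  by apply: cvgM; [exact: cvg_cst | exact: mM].
move/cvgrPdist_le => /(_ _ e4) [N _ NL]; exists N => n m nN mN.
have := NL n nN; have := NL m mN; rewrite /=.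
have := close n; have := close m.
move: (Rintegral _ _ _) (Rintegral _ _ _) (Rintegral _ _ _) (Rintegral _ _ _) => a b c d.
by rewrite !ler_norml; lra.
Qed.

End moments_on_segment.

(** * Distribution functions, determinacy and quantiles *)

Section distribution_functions.
Context {R : realType}.
Implicit Types (mu nu : probability R R).

Definition clamp01 (t : R) : R := Num.max 0 (Num.min 1 t).

Lemma clamp01_itv t : 0 <= clamp01 t <= 1.
Proof. by rewrite /clamp01 le_max lexx /= ge_max ler01 ge_min lexx. Qed.

Lemma clamp01_lipschitz s t : `|clamp01 s - clamp01 t| <= `|s - t|.
Proof.
have E r : clamp01 r = if r < 0 then 0 else if 1 < r then 1 else r.
  rewrite /clamp01; case: (ltP 1 r) => [r1|r1].
    by rewrite (max_idPr ler01) ltNge (le_trans ler01 (ltW r1)).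
  by case: (ltP r 0).
have := ler_norm (s - t); have := ler_norm (t - s); rewrite (distrC t s) !E ler_norml.
by case: (ltP s 0); case: (ltP t 0); case: (ltP 1 s); case: (ltP 1 t); lra.
Qed.

Lemma clamp01_id t : 0 <= t <= 1 -> clamp01 t = t.
Proof. by move=> /andP[t0 t1]; rewrite /clamp01 (min_idPr t1) (max_idPr t0). Qed.

Lemma clamp01_nd s t : s <= t -> clamp01 s <= clamp01 t.
Proof. by move=> st; rewrite /clamp01 le_max2 // le_min2. Qed.

Lemma measurable_clamp01 : measurable_fun setT clamp01.
Proof. by apply: nondecreasing_measurable => // s t; exact: clamp01_nd. Qed.

(** For a < b, a Lipschitz substitute for the indicator of a half-line: it is 1 up to
    a and 0 from b on, and affine in between. *)
Definition ramp (a b x : R) : R := clamp01 ((b - x) / (b - a)).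

Lemma ramp_lipschitz a b x y : a < b ->
  `|ramp a b x - ramp a b y| <= (b - a)^-1 * `|x - y|.
Proof.
move=> ab; have ab0 : 0 < b - a by rewrite subr_gt0.
apply: le_trans (clamp01_lipschitz _ _) _.
rewrite -mulrBl (_ : b - x - (b - y) = - (x - y)); last by ring.
by rewrite normrM normrN normfV (gtr0_norm ab0) mulrC.
Qed.

Lemma measurable_ramp a b : a < b -> measurable_fun setT (ramp a b).
Proof.
move=> ab; have ab0 : 0 < b - a by rewrite subr_gt0.
apply: nonincreasing_measurable => // x y xy; apply: clamp01_nd.
by rewrite ler_pM2r ?invr_gt0 // lerD2l lerN2.
Qed.

Lemma ramp_le a b x : a < b -> x <= a -> ramp a b x = 1.
Proof.
move=> ab xa; rewrite /ramp /clamp01 (_ : Num.min 1 _ = 1) ?(max_idPr ler01) //.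
by apply/min_idPl; rewrite ler_pdivlMr ?subr_gt0 // mul1r lerD2l lerN2.
Qed.

Lemma ramp_ge a b x : a < b -> b <= x -> ramp a b x = 0.
Proof.
move=> ab bx; rewrite /ramp /clamp01; apply/max_idPl; rewrite ge_min; apply/orP; right.
by rewrite ler_pdivrMr ?subr_gt0 // mul0r subr_le0.
Qed.

Definition dist_fun mu (x : R) : R := fine (mu `]-oo, x]%classic).

Lemma EFin_dist_fun mu x : (dist_fun mu x)%:E = mu `]-oo, x]%classic.
Proof. by rewrite /dist_fun fineK // fin_num_measure. Qed.

Lemma dist_fun_nd mu x y : x <= y -> dist_fun mu x <= dist_fun mu y.
Proof.
move=> xy; rewrite -lee_fin !EFin_dist_fun; apply: le_measure.
- exact/mem_set.
- exact/mem_set.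
- by apply: subset_itvl; rewrite bnd_simp.
Qed.

Lemma dist_fun_itv mu x : 0 <= dist_fun mu x <= 1.
Proof.
rewrite -[0 <= _]lee_fin -[_ <= 1]lee_fin !EFin_dist_fun.
by rewrite measure_ge0 probability_le1.
Qed.

Lemma dist_fun_right_continuous mu x u :
  (forall y, x < y -> u <= dist_fun mu y) -> u <= dist_fun mu x.
Proof.
move=> xu; rewrite -lee_fin EFin_dist_fun.
have cv : mu (`]-oo, x + n.+1%:R^-1]%classic) @[n --> \oo] -->
    mu (\bigcap_n `]-oo, x + n.+1%:R^-1]%classic).
  apply: nonincreasing_cvg_mu => //.
  - by apply: le_lt_trans (probability_le1 mu _) (ltry 1).
  - exact: bigcap_measurable.
  - move=> m n mn; apply/subsetPset/subset_itvl; rewrite bnd_simp lerD2l.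
    by rewrite lef_pV2 ?posrE // ler_nat.
rewrite (_ : `]-oo, x]%classic = \bigcap_n `]-oo, x + n.+1%:R^-1]%classic); last first.
  apply/seteqP; split=> y /=; rewrite in_itv /=.
    by move=> yx n _ /=; rewrite in_itv /= (le_trans yx) // lerDl.
  move=> h; apply/ler_addgt0Pr => e e0.
  have /= := h (Num.truncn e^-1) Logic.I; rewrite in_itv /= => /le_trans; apply.
  rewrite lerD2l invf_ple ?posrE //; exact/ltW/truncnS_gt.
apply: (cvge_ge _ cv); apply: nearW => n.
by rewrite -EFin_dist_fun lee_fin xu // ltrDl invr_gt0.
Qed.

(** Half-lines are stable under intersection and generate the Borel sets. *)
Lemma eq_dist_fun mu nu : dist_fun mu =1 dist_fun nu ->
  forall A, measurable A -> mu A = nu A.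
Proof.
move=> E; pose G : set (set R) := [set A | exists x : R, A = `]-oo, x]%classic].
apply: (@measure_unique _ _ _ G (fun n => `]-oo, n%:R]%classic)).
- rewrite eqEsubset; split => B.
    apply: smallest_sub; first exact: smallest_sigma_algebra.
    move=> _ [[a b] _ <-] /=.
    have mG x : G.-sigma.-measurable `]-oo, x]%classic.
      by apply: sub_sigma_algebra; exists x.
    rewrite (_ : `]a, b]%classic = `]-oo, b]%classic `\` `]-oo, a]%classic).
      exact: (@measurableD _ (g_sigma_algebraType G) _ _ (mG b) (mG a)).
    apply/seteqP; split=> x /=; rewrite !in_itv /=.
      by move=> /andP[ax ->]; split=> //; apply/negP; rewrite -ltNge.
    by move=> [-> /negP]; rewrite -ltNge => ->.
  apply: smallest_sub; first exact: (@sigma_algebra_measurable _ R).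
  by move=> _ [x ->]; exact: measurable_itv.
- move=> _ _ [x ->] [y ->]; exists (Num.min x y).
  by apply/seteqP; split=> z /=; rewrite !in_itv /= le_min; [move=> [-> ->]|move=> /andP].
- by move=> n; exists n%:R.
- apply/seteqP; split=> // x _; exists (Num.truncn x).+1 => //=.
  by rewrite in_itv /= ltW // truncnS_gt.
- by move=> _ [x ->]; rewrite -[LHS](EFin_dist_fun mu x) -[RHS](EFin_dist_fun nu x) E.
- by move=> n; apply: le_lt_trans (probability_le1 mu _) (ltry 1).
Qed.

End distribution_functions.

Lemma probability_setC_eq0 d (T : measurableType d) (R : realType)
    (P : probability T R) (A : set T) :
  measurable A -> P A = 1%E -> P (~` A) = 0%E.
Proof. by move=> mA PA; rewrite probability_setC // PA subee. Qed.

Section determinacy.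
Context {R : realType}.
Implicit Types (mu nu : probability R R).
Local Notation seg := `[(-1)%R, 1%R]%classic.

Lemma measure_segment_full mu (A : set R) : mu seg = 1%E -> measurable A ->
  mu (A `&` seg) = mu A.
Proof.
move=> mu1 mA; have mS : measurable (seg : set R) by exact: measurable_itv.
have N0 : mu (~` seg) = 0%E by exact: probability_setC_eq0.
rewrite [RHS](@measureDI _ _ _ mu A seg) // [X in (X + _)%E](_ : _ = 0%E) ?add0e //.
apply: (subset_measure0 _ _ _ N0).
- exact: measurableD.
- exact: measurableC.
- by move=> x [].
Qed.

Lemma dist_fun_ramp mu a b : mu seg = 1%E -> a < b ->
  dist_fun mu a <= \int[mu]_(x in seg) ramp a b x <= dist_fun mu b.
Proof.
move=> mu1 ab.
have ind1 (c x : R) : `|\1_(`]-oo, c]%classic) x| <= 1 :> R.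
  by rewrite indicE; case: (_ \in _); rewrite ?normr1 ?normr0.
have dE c : dist_fun mu c = \int[mu]_(x in seg) \1_(`]-oo, c]%classic) x.
  rewrite /Rintegral integral_indic //.
  by congr fine; exact/esym/measure_segment_full.
have iI c : mu.-integrable seg (EFin \o (\1_(`]-oo, c]%classic) : R -> R)).
  by apply: (@segment_integrable _ _ _ 1) => //; exact: measurable_indic.
have iR : mu.-integrable seg (EFin \o ramp a b).
  apply: (@segment_integrable _ _ _ 1) => [|x _]; first exact: measurable_ramp.
  by have /andP[r0 r1] := clamp01_itv ((b - x) / (b - a)); rewrite ger0_norm.
rewrite !dE; apply/andP; split; apply: le_Rintegral => // x _; rewrite indicE.
  have /andP[r0 r1] := clamp01_itv ((b - x) / (b - a)).
  have [xa|] := boolP (x \in _); last by [].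
  by move/set_mem: xa; rewrite /= in_itv /= => xa; rewrite ramp_le.
have [xb|xb] := boolP (x \in _).
  by have /andP[r0 r1] := clamp01_itv ((b - x) / (b - a)).
rewrite ramp_ge //; rewrite leNgt; apply: contra xb => xb.
by apply/mem_set; rewrite /= in_itv /= ltW.
Qed.

Lemma cauchy_ramp (mu_ : nat -> probability R R) (M : nat -> R) a b e :
  (forall k, moment (mu_ n) k @[n --> \oo] --> M k) -> a < b -> 0 < e ->
  exists N, forall n m, (N <= n)%N -> (N <= m)%N ->
  `|\int[mu_ n]_(x in seg) ramp a b x - \int[mu_ m]_(x in seg) ramp a b x| <= e.
Proof.
move=> mM ab; have ab0 : 0 < (b - a)^-1 by rewrite invr_gt0 subr_gt0.
apply: (cauchy_lipschitz_integral mM ab0) => [x y|]; first exact: ramp_lipschitz.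
exact: measurable_ramp.
Qed.

(** The alternating sequence mu, nu, mu, ... has convergent moments, so the integrals
    of every ramp under mu and nu are equal, and ramps squeeze distribution
    functions. *)
Lemma moment_determinacy mu nu : mu seg = 1%E -> nu seg = 1%E ->
  moment mu =1 moment nu -> forall A, measurable A -> mu A = nu A.
Proof.
move=> mu1 nu1 E; apply: eq_dist_fun.
suff le_dist (P Q : probability R R) : P seg = 1%E -> Q seg = 1%E ->
    moment P =1 moment Q -> forall x, dist_fun P x <= dist_fun Q x.
  by move=> x; apply/eqP; rewrite eq_le !le_dist // => k; rewrite E.
move=> P1 Q1 PQ x; apply: dist_fun_right_continuous => y xy.
pose mu_ n := if odd n then P else Q.
have mu_M k : moment (mu_ n) k @[n --> \oo] --> moment P k.
  rewrite (_ : (fun n => moment (mu_ n) k) = fun=> moment P k); first exact: cvg_cst.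
  by apply/funext => n; rewrite /mu_; case: (odd n).
apply/ler_addgt0Pr => e e0.
have [N NE] := cauchy_ramp mu_M xy e0.
have := NE (2 * N).+1 (2 * N)%N; rewrite /mu_ /= oddM /= => h.
have {h} := h _ _; rewrite ler_norml => h.
have /andP[P_le _] := dist_fun_ramp P1 xy; have /andP[_ Q_ge] := dist_fun_ramp Q1 xy.
have /andP[_ ] := h ltac:(lia) ltac:(lia); lra.
Qed.

End determinacy.

Section quantile.
Context {R : realType} (mu : probability R R).
Local Notation seg := `[(-1)%R, 1%R]%classic.
Hypothesis mu1 : mu seg = 1%E.

(** Intersecting with the segment and truncating the level at 1 make the set nonempty
    and bounded below for every real u, not only for u in ]0, 1[; the function is
    then monotone on the whole line, which gives its measurability. *)
Definition quantile (u : R) : R :=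
  inf [set x | -1 <= x <= 1 /\ Num.min u 1 <= dist_fun mu x].

Lemma dist_fun_top : dist_fun mu 1 = 1.
Proof.
rewrite /dist_fun -(measure_segment_full mu1) // setIidr ?mu1 // => x /=.
by rewrite !in_itv /= => /andP[].
Qed.

Let quantile_set1 u : [set x | -1 <= x <= 1 /\ Num.min u 1 <= dist_fun mu x] 1.
Proof. by split; [rewrite lexx andbT; lra | rewrite dist_fun_top ge_min lexx orbT]. Qed.

Let quantile_lbound u :
  lbound [set x | -1 <= x <= 1 /\ Num.min u 1 <= dist_fun mu x] (-1).
Proof. by move=> x [/andP[]]. Qed.

Lemma quantile_itv u : -1 <= quantile u <= 1.
Proof.
apply/andP; split.
  by apply: lb_le_inf; [exists 1; exact: quantile_set1|exact: quantile_lbound].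
by apply: ge_inf; [exists (-1); exact: quantile_lbound|exact: quantile_set1].
Qed.

Lemma quantile_le u x : -1 <= x <= 1 ->
  (quantile u <= x) = (Num.min u 1 <= dist_fun mu x).
Proof.
move=> x11; apply/idP/idP => [ux|ux]; last first.
  by apply: ge_inf; [exists (-1); exact: quantile_lbound|split].
apply: dist_fun_right_continuous => y xy.
have [z [z11 zu] zy] := inf_lt (ex_intro _ 1 (quantile_set1 u)) (le_lt_trans ux xy).
exact: le_trans zu (dist_fun_nd mu (ltW zy)).
Qed.

Lemma quantile_nd u v : u <= v -> quantile u <= quantile v.
Proof.
move=> uv; rewrite quantile_le ?quantile_itv //.
apply: le_trans (_ : Num.min v 1 <= _); first by rewrite le_min2.
by rewrite -quantile_le ?quantile_itv.
Qed.

Lemma measurable_quantile : measurable_fun setT (quantile : measurableTypeR R -> R).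
Proof. by apply: nondecreasing_measurable => // u v; exact: quantile_nd. Qed.

End quantile.

Section quantile_transform.
Context {R : realType}.
Implicit Types (mu : probability R R).
Local Notation seg := `[(-1)%R, 1%R]%classic.

Definition unif01 : probability (measurableTypeR R) R := uniform_prob (@ltr01 R).

Lemma unif01_le (y : R) : 0 <= y <= 1 -> unif01 `]-oo, y]%classic = y%:E.
Proof.
move=> /andP[y0 y1]; rewrite /unif01 /= /uniform_prob integral_uniform_pdf.
rewrite (_ : `]-oo, y]%classic `&` `[0, 1]%classic = `[0, y]%classic); last first.
  apply/seteqP; split=> x /=; rewrite !in_itv /=.
    by move=> [xy /andP[x0 x1]]; rewrite x0.
  by move=> /andP[x0 xy]; split=> //; rewrite x0 (le_trans xy).
rewrite (eq_integral (cst 1%E)); last first.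
  move=> x /set_mem /=; rewrite in_itv /= => /andP[x0 xy].
  by rewrite /uniform_pdf x0 (le_trans xy y1) subr0 invr1.
rewrite integral_cst //= mul1e lebesgue_measure_itv /= lte_fin.
by case: ltgtP y0 => // [y0|<-] _; rewrite ?oppr0 ?adde0 // sube0.
Qed.

(** Image measures are formed from bundled measurable functions. *)
Lemma mfun_of d d' (T : measurableType d) (T' : measurableType d') (f : T -> T') :
  measurable_fun setT f -> exists g : {mfun T >-> T'}, g = f :> (T -> T').
Proof. by move=> mf; exists (mfun_Sub (mem_set mf)). Qed.

(** The quantile function transports the uniform law to mu, by the Galois connection
    between quantiles and distribution functions. *)
Lemma distribution_quantile mu (g : {mfun measurableTypeR R >-> R}) :
  mu seg = 1%E -> g = quantile mu :> (R -> R) ->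
  forall A, measurable A -> distribution unif01 g A = mu A.
Proof.
move=> mu1 gE; apply: eq_dist_fun => x; rewrite /dist_fun; congr fine.
rewrite -[LHS]/(unif01 (g @^-1` `]-oo, x]%classic)) gE.
have [x1|x1] := ltP x (-1).
  rewrite (_ : _ @^-1` _ = set0).
    rewrite measure0 -[RHS](measure_segment_full mu1) // (_ : _ `&` _ = set0) ?measure0 //.
    apply/seteqP; split=> // y [] /=; rewrite !in_itv /= => yx /andP[y1 _].
    by have := le_lt_trans y1 (le_lt_trans yx x1); rewrite ltxx.
  apply/seteqP; split=> // u /=; rewrite in_itv /= => ux.
  have /andP[q _] := quantile_itv mu1 u.
  by have := le_lt_trans q (le_lt_trans ux x1); rewrite ltxx.
have full : 1 <= dist_fun mu x -> mu `]-oo, x]%classic = 1%E.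
  move=> Fx; apply/eqP; rewrite eq_le probability_le1 //=.
  by rewrite -EFin_dist_fun lee_fin.
have [x2|x2] := leP 1 x.
  rewrite (_ : _ @^-1` _ = setT) ?probability_setT.
    by rewrite full // -(dist_fun_top mu1) dist_fun_nd.
  apply/seteqP; split=> // u _ /=; rewrite in_itv /=.
  by have /andP[_ q] := quantile_itv mu1 u; exact: le_trans x2.
have x11 : -1 <= x <= 1 by rewrite x1 ltW.
have [F1|F1] := leP 1 (dist_fun mu x).
  rewrite (_ : _ @^-1` _ = setT) ?probability_setT ?full //.
  apply/seteqP; split=> // u _ /=; rewrite in_itv /= quantile_le //.
  by rewrite ge_min F1 orbT.
rewrite (_ : _ @^-1` _ = `]-oo, dist_fun mu x]%classic).
  by rewrite unif01_le ?dist_fun_itv // EFin_dist_fun.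
apply/seteqP; split=> u /=; rewrite !in_itv /= quantile_le // ge_min.
  by move=> /orP[//|]; rewrite leNgt F1.
by move=> ->.
Qed.

Lemma segment_integral_distribution (g : {mfun measurableTypeR R >-> R})
    (f : R -> R) (M : R) :
  (forall u, -1 <= g u <= 1) ->
  measurable_fun setT f -> (forall x, -1 <= x <= 1 -> `|f x| <= M) ->
  \int[distribution unif01 g]_(x in seg) f x = \int[unif01]_u f (g u).
Proof.
move=> g11 mf fM.
rewrite Rintegral_mkcond /Rintegral; congr fine.
have gI u : g u \in (seg : set R) by apply/mem_set; rewrite /= in_itv /=.
have E : (fun u => (patch (fun=> point) seg f (g u))%:E) = (fun u => (f (g u))%:E).
  by apply/funext => u; rewrite patchE gI.
rewrite integral_distribution.
- by rewrite /comp /= E.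
- apply/measurable_EFinP; apply/measurable_restrict => //; exact: measurable_funTS.
rewrite /comp /= E; apply: (@bounded_measurable_integrable _ _ _ unif01 (f \o g)).
split; first by apply: measurableT_comp => //; exact: measurable_funPT.
by exists M => u /=; exact: fM.
Qed.

Lemma segment_integral_quantile mu (f : R -> R) (M : R) :
  mu seg = 1%E -> measurable_fun setT f -> (forall x, -1 <= x <= 1 -> `|f x| <= M) ->
  \int[mu]_(x in seg) f x = \int[unif01]_u f (quantile mu u).
Proof.
move=> mu1 mf fM; have [g gE] := mfun_of (measurable_quantile mu1).
have g11 u : -1 <= g u <= 1 by rewrite gE; exact: quantile_itv.
rewrite -gE -(segment_integral_distribution g11 mf fM) /Rintegral; congr fine.
by apply: eq_measure_integral => A mA _; exact/esym/distribution_quantile.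
Qed.

End quantile_transform.

(** * Convergence of moments implies Wasserstein convergence *)

Lemma cvgX_seq (R : realType) (u : nat -> R) (l : R) k :
  u n @[n --> \oo] --> l -> u n ^+ k @[n --> \oo] --> l ^+ k.
Proof.
move=> ul; elim: k => [|k IHk]; first exact: cvg_cst.
under eq_fun do rewrite exprS.
by rewrite exprS; exact: cvgM.
Qed.

Lemma bounded_cvg_Rintegral d (T : measurableType d) (R : realType)
    (P : probability T R) (f_ : nat -> T -> R) (f : T -> R) (B : R) :
  (forall n, measurable_fun setT (f_ n)) -> measurable_fun setT f ->
  (forall n x, `|f_ n x| <= B) -> {ae P, forall x, f_ n x @[n --> \oo] --> f x} ->
  \int[P]_x f_ n x @[n --> \oo] --> \int[P]_x f x.
Proof.
move=> mf_ mf fB cf.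
have iB := @bounded_measurable_integrable _ _ _ P _ (@bounded_measurable_cst _ T R B).
have mf_' n : measurable_fun setT (EFin \o f_ n) by exact/measurable_EFinP.
have mf' : measurable_fun setT (EFin \o f) by exact/measurable_EFinP.
have cf' : {ae P, forall x, setT x -> (EFin \o f_ n) x @[n --> \oo] --> (EFin \o f) x}.
  by apply: filterS cf => x fx _; apply: cvg_EFin => //; exact: nearW.
have fB' : {ae P, forall x n, setT x -> (`|(EFin \o f_ n) x| <= (EFin \o (fun=> B)) x)%E}.
  by apply: aeW => x n _; rewrite /= lee_fin.
have [If _ c] := dominated_convergence measurableT mf_' mf' cf' iB fB'.
apply: fine_cvg; rewrite fineK; first exact: c.
exact: integrable_fin_num.
Qed.

Lemma cvg_powR0 (R : realType) (x : nat -> R) (s : R) : 0 < s ->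
  (forall n, 0 <= x n) -> x n @[n --> \oo] --> (0 : R) ->
  x n `^ s @[n --> \oo] --> (0 : R).
Proof.
move=> s0 x0 xc; apply/cvgrPdist_le => e e0.
move/cvgrPdist_le : xc => /(_ (e `^ s^-1) (powR_gt0 _ e0)); apply: filterS => n.
rewrite !sub0r !normrN !ger0_norm ?powR_ge0 // => xe.
rewrite (_ : e = (e `^ s^-1) `^ s); last by rewrite -powRrM mulVf ?gt_eqF // powRr1 // ltW.
by apply: ge0_ler_powR => //; [exact: ltW | rewrite nnegrE | rewrite nnegrE powR_ge0].
Qed.

Section moment_convergence.
Context {R : realType}.
Local Notation seg := `[(-1)%R, 1%R]%classic.
Variables (mu_ : nat -> probability R R) (M : nat -> R).
Hypothesis mu1 : forall n, mu_ n seg = 1%E.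
Hypothesis mM : forall k, moment (mu_ n) k @[n --> \oo] --> M k.

Let q n u := quantile (mu_ n) u.
Let q11 n u : -1 <= q n u <= 1. Proof. exact: quantile_itv. Qed.

(* lo and hi are the lower and upper limits of the quantiles q n u. *)
Let below u := [set x : R | \forall n \near \oo, x <= q n u].
Let above u := [set x : R | \forall n \near \oo, q n u <= x].
Let lo u : R := sup (below u).
Let hi u : R := inf (above u).

Let below1 u : below u (-1).
Proof. by apply: nearW => n; have /andP[] := q11 n u. Qed.

Let above1 u : above u 1.
Proof. by apply: nearW => n; have /andP[] := q11 n u. Qed.

Let below_above u x y : below u x -> above u y -> x <= y.
Proof.
move=> bx ay; near \oo => n; apply: (@le_trans _ _ (q n u)).
  by near: n.
by near: n.
Unshelve. all: by end_near. Qed.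

Let has_sup_below u : has_sup (below u).
Proof.
split; first by exists (-1); exact: below1.
by exists 1 => x /below_above; apply; exact: above1.
Qed.

Let has_inf_above u : has_inf (above u).
Proof.
split; first by exists 1; exact: above1.
by exists (-1) => x; apply: below_above; exact: below1.
Qed.

Let lo11 u : -1 <= lo u <= 1.
Proof.
apply/andP; split; first by apply: ub_le_sup (below1 u); case: (has_sup_below u).
by apply: ge_sup => [|x /below_above]; [exists (-1); exact: below1 | apply; exact: above1].
Qed.

Let not_near (A : nat -> Prop) : ~ (\forall n \near \oo, A n) ->
  forall N, exists2 n, (N <= n)%N & ~ A n.
Proof.
move=> nA N; apply: contrapT => h; apply: nA; exists N => // n /= Nn.
by apply: contrapT => An; apply: h; exists n.
Qed.

(* Otherwise, for a < b strictly between lo v and hi u, infinitely many n give mass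
   at least v to the half-line up to a, and infinitely many m give mass less than
   u to the half-line up to b; the integrals of the ramp from a to b would then
   fail to be a Cauchy sequence. *)
Let hi_le_lo u v : 0 < u -> u < v -> v < 1 -> hi u <= lo v.
Proof.
move=> u0 uv v1; rewrite leNgt; apply/negP => lh.
pose a := (2 * lo v + hi u) / 3; pose b := (lo v + 2 * hi u) / 3.
have la : lo v < a by rewrite /a; lra.
have ab : a < b by rewrite /a /b; lra.
have bh : b < hi u by rewrite /b; lra.
have /andP[l1 _] := lo11 v.
have h1 : hi u <= 1 by apply: ge_inf (above1 u); case: (has_inf_above u).
have a11 : -1 <= a <= 1 by rewrite /a; lra.
have b11 : -1 <= b <= 1 by rewrite /b; lra.
have uv0 : 0 < (v - u) / 2 by rewrite divr_gt0 ?subr_gt0.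
have [N NE] := cauchy_ramp mM ab uv0.
have [n nN qa] : exists2 n, (N <= n)%N & ~ (a <= q n v).
  apply: not_near => h; move: la; rewrite ltNge => /negP; apply.
  by apply: ub_le_sup h; case: (has_sup_below v).
have [m mN qb] : exists2 m, (N <= m)%N & ~ (q m u <= b).
  apply: not_near => h; move: bh; rewrite ltNge => /negP; apply.
  by apply: ge_inf h; case: (has_inf_above u).
have va : v <= dist_fun (mu_ n) a.
  have : q n v <= a by rewrite ltW // ltNge; exact/negP.
  by rewrite /q quantile_le // (min_idPl _) // ltW.
have ub : dist_fun (mu_ m) b < u.
  move/negP: qb; rewrite /q quantile_le // -ltNge => /lt_le_trans; apply.
  by rewrite ge_min lexx.
have := NE n m nN mN; rewrite ler_norml.
have /andP[ra _] := dist_fun_ramp (mu1 n) ab.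
have /andP[_ rb] := dist_fun_ramp (mu1 m) ab.
by move=> /andP[_]; lra.
Qed.

Let lo_nd u v : u <= v -> lo u <= lo v.
Proof.
move=> uv; apply: ge_sup => [|x xu]; first by exists (-1); exact: below1.
apply: ub_le_sup; first by case: (has_sup_below v).
by apply: filterS xu => n /le_trans; apply; exact: quantile_nd.
Qed.

Let cvg_lo u : hi u <= lo u -> q n u @[n --> \oo] --> lo u.
Proof.
move=> hl; apply/cvgrPdist_le => e e0.
have [x xu lx] : exists2 x, below u x & lo u - e < x.
  by apply: sup_gt; [exists (-1); exact: below1 | rewrite ltrBlDr ltrDl].
have [y yu yh] : exists2 y, above u y & y < lo u + e.
  by apply: inf_lt; [exists 1; exact: above1 | rewrite (le_lt_trans hl) // ltrDl].
near=> n.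
have : x <= q n u by near: n.
have : q n u <= y by near: n.
by rewrite ler_norml; lra.
Unshelve. all: by end_near. Qed.

(* The open intervals from lo u to hi u are pairwise disjoint by hi_le_lo; choosing a
   rational number in each of them is injective. *)
Let countable_jumps : countable [set u | 0 < u < 1 /\ lo u < hi u].
Proof.
apply/countable_injP.
pose r u : rat := xget 0 [set r : rat | lo u < ratr r < hi u].
exists (fun u : R => choice.pickle (r u)) => u v.
move=> /set_mem[/= /andP[u0 u1] lhu] /set_mem[/= /andP[v0 v1] lhv].
move/(pcan_inj choice.pickleK) => ruv.
have rP w : lo w < hi w -> lo w < ratr (r w) < hi w.
  move=> /rat_in_itvoo[s]; rewrite in_itv /= => ws.
  exact: (@xgetPex _ _ [set r : rat | lo w < ratr r < hi w] (ex_intro _ s ws)).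
have /andP[ur ru] := rP u lhu; have /andP[vr rv] := rP v lhv.
have [uv|vu|//] := ltgtP u v.
  by have := lt_le_trans ru (le_trans (hi_le_lo u0 uv v1) (ltW vr)); rewrite ruv ltxx.
by have := lt_le_trans rv (le_trans (hi_le_lo v0 vu u1) (ltW ur)); rewrite ruv ltxx.
Qed.

Let cvg_quantile : {ae (@unif01 R), forall u, q n u @[n --> \oo] --> lo u}.
Proof.
pose D := [set u | 0 < u < 1 /\ lo u < hi u].
have mD : measurable (D : set (measurableTypeR R)).
  exact: countable_measurable countable_jumps.
have D0 : unif01 D = 0%E.
  have /null_content_dominatesP := dominates_uniform_prob (@ltr01 R).
  by apply => //; exact: countable_lebesgue_measure0 countable_jumps.
have L0 : unif01 (`]-oo, (0:R)]%classic) = 0%E by rewrite unif01_le // lexx ler01.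
have R0 : unif01 (`[(1:R), +oo[%classic) = 0%E.
  rewrite /unif01 /= /uniform_prob integral_uniform_pdf.
  rewrite (_ : _ `&` _ = [set 1]) ?integral_set1 //.
  apply/seteqP; split=> x /=; rewrite !in_itv /= andbT.
    by move=> [x1 /andP[_ x2]]; apply/eqP; rewrite eq_le x1 x2.
  by move=> ->; rewrite lexx ler01.
exists (D `|` (`]-oo, (0:R)]%classic `|` `[(1:R), +oo[%classic)); split.
- by apply: measurableU => //; apply: measurableU => //; exact: measurable_itv.
- rewrite null_set_setU // ?null_set_setU //.
  by apply: measurableU; exact: measurable_itv.
move=> u /= nc; have [u0|u0] := leP u 0; first by right; left; rewrite /= in_itv.
have [u1|u1] := leP 1 u; first by right; right; rewrite /= in_itv /= u1.
left; split; first by rewrite u0.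
by rewrite ltNge; apply/negP => /cvg_lo.
Qed.

(** The limit is the image of the uniform law under the limit of the quantiles. The
    joint law of q n and this limit under the uniform law is a coupling, and its cost
    tends to 0 by bounded convergence, whatever the exponent. *)
Theorem cvg_moments_wasserstein : exists mu : probability R R,
  [/\ mu seg = 1%E, moment mu =1 M &
      forall p, 1 <= p -> wasserstein p (mu_ n) mu @[n --> \oo] --> 0%E].
Proof.
have mq n : measurable_fun setT (q n : measurableTypeR R -> R).
  exact: measurable_quantile.
have mlo : measurable_fun setT (lo : measurableTypeR R -> R).
  by apply: nondecreasing_measurable => // u v; exact: lo_nd.
have [G GE] := mfun_of mlo.
have G11 u : -1 <= G u <= 1 by rewrite GE.
exists (distribution unif01 G); split.
- rewrite -[LHS]/(unif01 (G @^-1` seg)) (_ : G @^-1` seg = setT) ?probability_setT //.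
  by apply/seteqP; split=> // u _; rewrite /= in_itv /=.
- move=> k.
  have mX : measurable_fun setT (fun x : R => x ^+ k) by [].
  have X1 (x : R) : -1 <= x <= 1 -> `|x ^+ k| <= 1.
    by move=> x11; rewrite normrX exprn_ile1 // ler_norml.
  rewrite /moment (segment_integral_distribution G11 mX X1) GE.
  suff c : moment (mu_ n) k @[n --> \oo] --> \int[unif01]_u (lo u ^+ k).
    by rewrite -(cvg_lim (@Rhausdorff R) c) (cvg_lim (@Rhausdorff R) (@mM k)).
  rewrite (_ : (fun n => moment (mu_ n) k) = fun n => \int[unif01]_u (q n u ^+ k)); last first.
    by apply/funext => n; rewrite /moment (segment_integral_quantile (mu1 _) mX X1).
  apply: (@bounded_cvg_Rintegral _ _ _ unif01 _ _ 1) => [n||n u|].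
  + exact: measurableT_comp mX (mq n).
  + exact: measurableT_comp mX mlo.
  + by apply: X1; exact: q11.
  + case: cvg_quantile => N [mN N0 sN]; exists N; split=> // u nu.
    apply: sN => qu; apply: nu.
    exact: cvgX_seq.
- move=> p p1; have p0 : 0 < p by lra.
  pose D n : R := \int[unif01]_u (`|q n u - lo u| `^ p).
  have D0 n : 0 <= D n by apply: Rintegral_ge0 => u _; exact: powR_ge0.
  have mpow n : measurable_fun setT (fun u : measurableTypeR R => `|q n u - lo u| `^ p).
    apply: (measurableT_comp (measurable_powR p)).
    by apply: measurableT_comp => //; exact: measurable_funB (mq n) mlo.
  have dist2 n u : 0 <= `|q n u - lo u| `^ p <= 2 `^ p.
    rewrite powR_ge0 /=; apply: ge0_ler_powR; rewrite ?nnegrE //; first exact: ltW.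
    by have := q11 n u; have := lo11 u; rewrite ler_norml; lra.
  have Dcvg : D n @[n --> \oo] --> (0 : R).
    have -> : 0 = \int[unif01]_u 0 :> R by rewrite Rintegral_cst // mul0r.
    apply: (@bounded_cvg_Rintegral _ _ _ unif01 _ _ (2 `^ p)) => //.
      by move=> n u; have /andP[d0 d2] := dist2 n u; rewrite ger0_norm.
    case: cvg_quantile => N [mN N0 sN]; exists N; split=> // u nu.
    apply: sN => qu; apply: nu => /=; apply: cvg_powR0 => //.
    apply/norm_cvg0P; rewrite -(subrr (lo u)).
    by apply: cvgB => //; exact: cvg_cst.
  have W0 n : (0 <= wasserstein p (mu_ n) (distribution unif01 G))%E.
    by apply: le_ereal_inf_tmp => _ [Pi _ <-]; exact: poweR_ge0.
  have WD n : (wasserstein p (mu_ n) (distribution unif01 G) <= (D n `^ p^-1)%:E)%E.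
    have mpair : measurable_fun setT (fun u : measurableTypeR R => (q n u, lo u) : R * R).
      exact/measurable_fun_pair.
    have [H HE] := mfun_of mpair.
    have [g gE] := mfun_of (mq n).
    apply: ereal_inf_lbound; exists (distribution unif01 H).
      move=> A mA; split.
        transitivity (unif01 (g @^-1` A)); last exact: (distribution_quantile (mu1 n) gE mA).
        rewrite -[LHS]/(unif01 (H @^-1` (A `*` setT))).
        by congr (unif01 _); rewrite HE gE; apply/seteqP; split=> u //= [].
      rewrite -[LHS]/(unif01 (H @^-1` (setT `*` A))) -[RHS]/(unif01 (G @^-1` A)).
      by congr (unif01 _); rewrite HE GE; apply/seteqP; split=> u //= [].
    have mdist : measurable_fun setT (fun z : R * R => (`|z.1 - z.2| `^ p)%:E).
      apply/measurable_EFinP; apply: (measurableT_comp (measurable_powR p)).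
      apply: measurableT_comp => //.
      exact: measurable_funB measurable_fst measurable_snd.
    rewrite ge0_integral_distribution // HE.
    rewrite -poweR_EFin /D /Rintegral fineK //.
    apply: integrable_fin_num => //.
    apply: (@bounded_measurable_integrable _ _ _ unif01 (fun u => `|q n u - lo u| `^ p)).
    exact: bounded_measurable_itv (mpow n) (dist2 n).
  apply: (@squeeze_cvge _ _ _ _ (cst 0%E) _ (fun n => (D n `^ p^-1)%:E)).
  + by apply: nearW => n; rewrite W0 WD.
  + exact: cvg_cst.
  + apply: cvg_EFin; first exact: nearW.
    by apply: cvg_powR0 => //; rewrite invr_gt0.
Qed.

End moment_convergence.

(** * Almost sure convergence of the traces *)

Lemma measurable_site_monomial (R : realType) s t :
  measurable_fun setT (@site_monomial R s t).
Proof.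
by apply: measurable_funM; [|apply: measurable_funX; apply: measurable_funB].
Qed.

Lemma clamped_site_expectation (R : realType) (L : probability R R) s t :
  L `[0, 1]%classic = 1%E ->
  \int[L]_x site_monomial s t (clamp01 x) = fine ('E_L[site_monomial s t]).
Proof.
move=> L01; rewrite unlock /Rintegral; congr fine.
have ms := @measurable_site_monomial R s t.
apply: ae_eq_integral => //.
- apply/measurable_EFinP; exact: measurableT_comp ms measurable_clamp01.
- exact/measurable_EFinP.
exists (~` `[0, 1]%classic); split; first exact: measurableC.
  exact: probability_setC_eq0.
move=> x; apply: contra_not => /=; rewrite in_itv /= => x01 _.
by rewrite clamp01_id.
Qed.

Lemma iid_ae_itv d (T : measurableType d) (R : realType) (P : probability T R)
    (L : probability R R) (V : nat -> {RV P >-> R}) (J : set nat) (a b : R) :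
  L `[a, b]%classic = 1%E -> iid J V L ->
  {ae P, forall w i, J i -> a <= V i w <= b}.
Proof.
move=> Lab [_ lawV]; apply: ae_foralln => i.
have [Ji|nJ] := pselect (J i); last exact: aeW.
exists (V i @^-1` (~` `[a, b]%classic)); split.
- rewrite -[X in measurable X]setTI; apply: measurable_funPT => //; exact: measurableC.
- rewrite -[LHS]/(distribution P (V i) (~` `[a, b]%classic)) lawV //; last exact: measurableC.
  exact: probability_setC_eq0.
- by move=> w /=; apply: contra_not; rewrite in_itv /=.
Qed.

Lemma ae_forall_countable d (T : measurableType d) (R : realType)
    (P : probability T R) (C : countType) (Q : C -> T -> Prop) :
  (forall c, {ae P, forall w, Q c w}) -> {ae P, forall w c, Q c w}.
Proof.
move=> aeQ; have optQ (o : option C) : {ae P, forall w, if o is Some c then Q c w else True}.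
  by case: o => [c|]; [exact: aeQ | exact: aeW].
apply: filterS (ae_foralln (fun k => optQ (choice.unpickle k))) => w Qw c.
by have := Qw (choice.pickle c); rewrite choice.pickleK.
Qed.

(** Up to a bounded error the trace is a finite sum, over closed walks, of sums of
    products over windows, to each of which the law of large numbers applies. *)
Lemma ae_trace_cvg d (T : measurableType d) (R : realType) (P : probability T R)
    (L : probability R R) (V : nat -> {RV P >-> R}) :
  L `[0, 1]%classic = 1%E -> iid [set i | (2 <= i)%N] V L ->
  {ae P, forall w, (forall i, (2 <= i)%N -> 0 <= V i w <= 1) /\
    forall m, \tr (birth_death_kernel n (fun i => V i w) ^+ m) / n%:R
      @[n --> \oo] --> loop_moment L m}.
Proof.
move=> L01 V_iid.
(* V i lies in [0, 1] only almost surely, hence the clamped functions. *)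
pose phi (s : seq bool) t (x : R) := site_monomial s t (clamp01 x).
pose avg (s : seq bool) w := (\sum_(0 <= j < n)
    \prod_(t < (2 * size s).+1) phi s t (V (j + 2 + t)%N w)) / n%:R @[n --> \oo]
    --> \prod_(t < (2 * size s).+1) \int[L]_x phi s t x.
have avgP s : {ae P, forall w, avg s w}.
  apply: (window_lln (2 * size s).+1 V_iid) => t.
    exact: measurableT_comp (measurable_site_monomial s t) measurable_clamp01.
  by move=> x; apply: site_monomial_itv; exact: clamp01_itv.
have all_avg := ae_forall_countable avgP.
apply: filterS2 (iid_ae_itv L01 V_iid) all_avg => w V01 wavg.
have V01' i : (1 < i)%N -> 0 <= V i w <= 1 by exact: V01.
split=> // m.
pose W n := \sum_(0 <= j < n) loop_weight m (fun i => V i w) j.+2.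
have Wcvg : W n / n%:R @[n --> \oo] --> loop_moment L m.
  have WE n : W n / n%:R =
      \sum_(s <- step_sequences m | (s \in step_sequences m) && (walk_end 0 s == 0))
        ((\sum_(0 <= j < n) \prod_(t < (2 * size s).+1) phi s t (V (j + 2 + t)%N w)) / n%:R).
    rewrite /W /loop_weight exchange_big /= mulr_suml big_seq_cond.
    apply: eq_bigr => s; rewrite mem_step_sequences => /andP[/eqP sm _]; rewrite sm.
    congr (_ / _); apply: eq_bigr => j _; apply: eq_bigr => t _.
    by rewrite /phi clamp01_id ?V01' // addn2.
  rewrite (funext WE) [loop_moment L m]big_seq_cond.
  apply: cvg_big => [|s]; first exact: add_continuous.
  rewrite mem_step_sequences => /andP[/eqP sm _].
  have := wavg s; rewrite /avg.
  by under eq_bigr do rewrite clamped_site_expectation //; rewrite sm.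
have err0 : ((2 * m).+2 * (2 ^ m).+1)%:R / n%:R @[n --> \oo] --> (0 : R).
  rewrite -(mulr0 ((2 * m).+2 * (2 ^ m).+1)%:R); apply: cvgM; first exact: cvg_cst.
  by rewrite -cvg_shiftS; exact: cvg_harmonic.
have dcvg : \tr (birth_death_kernel n (fun i => V i w) ^+ m) / n%:R - W n / n%:R
    @[n --> \oo] --> (0 : R).
  apply/norm_cvg0P; apply: (@squeeze_cvgr _ _ _ _ (cst 0)) err0; last exact: cvg_cst.
  apply: nearW => n; rewrite normr_ge0 /= -mulrBl normrM.
  by rewrite (@ger0_norm _ n%:R^-1) ?invr_ge0 // ler_wpM2r ?invr_ge0 // trace_loop_weight.
rewrite (_ : (fun n => \tr _ / _) = fun n =>
  \tr (birth_death_kernel n (fun i => V i w) ^+ m) / n%:R - W n / n%:R + W n / n%:R).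
  by rewrite -[loop_moment L m]add0r; exact: cvgD.
by apply/funext => n; rewrite subrK.
Qed.

(** * The empirical spectral measure *)

Lemma empirical_integral (R : realType) n (A : 'M[R]_n) (D : set R) (f : R -> R) :
  measurable D -> measurable_fun setT f ->
  (forall x, D x -> 0 <= f x) -> {in eigenvalues A, forall x, D x} ->
  (\int[empirical_spectral_measure A]_(x in D) (f x)%:E =
   ((\sum_(x <- eigenvalues A) f x) / n%:R)%:E)%E.
Proof.
move=> mD mf f0 AD.
have mf' : measurable_fun D (EFin \o f) by apply/measurable_EFinP; exact: measurable_funTS.
have f0' x : D x -> (0 <= (f x)%:E)%E by move=> Dx; rewrite lee_fin f0.
rewrite ge0_integral_mscale // ge0_integral_measure_sum // mulrC EFinM; congr (_ * _)%E.
rewrite (big_nth 0) big_mkord -sumEFin; apply: eq_bigr => k _.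
rewrite integral_dirac // diracE mem_set ?mul1e //.
by apply: AD; exact: mem_nth.
Qed.

(** The empirical measure has total mass one; normalising it is a way to bundle it as
    a probability measure. *)
Lemma empirical_probability (R : realType) n (A : 'M[R]_n.+1) :
  size (eigenvalues A) = n.+1 -> {in eigenvalues A, forall x, `|x| <= 1} ->
  exists mu : probability R R, [/\
    forall B, measurable B -> empirical_spectral_measure A B = mu B,
    mu `[-1, 1]%classic = 1%E &
    forall k, moment mu k = (\sum_(x <- eigenvalues A) x ^+ k) / n.+1%:R].
Proof.
move=> An A1.
have A11 : {in eigenvalues A, forall x, `[-1, 1]%classic x}.
  by move=> x /A1; rewrite ler_norml /= in_itv.
have mass1 (D : set R) : measurable D -> {in eigenvalues A, forall x, D x} ->
    empirical_spectral_measure A D = 1%E.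
  move=> mD AD; rewrite -[LHS]mul1e -integral_cst // (empirical_integral (f := cst 1)) //.
  by rewrite big_const_seq count_predT An iter_addr_0 divff // pnatr_eq0.
pose mu : probability R R := mnormalize (empirical_spectral_measure A) (dirac (0 : R)).
have muE B : measurable B -> empirical_spectral_measure A B = mu B.
  move=> mB; rewrite -[RHS]/(mnormalize (empirical_spectral_measure A) (dirac (0 : R)) B).
  by rewrite /mnormalize (mass1 setT) //= onee_eq0 /= invr1 mule1.
have mu1 : mu `[-1, 1]%classic = 1%E by rewrite -muE // mass1.
exists mu; split=> // k.
have X1 (x : R) : -1 <= x <= 1 -> `|x ^+ k| <= 1.
  by move=> x11; rewrite normrX exprn_ile1 // ler_norml.
have iX : mu.-integrable `[-1, 1] (EFin \o (fun x : R => x ^+ k)).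
  exact: segment_integrable X1.
have i1 : mu.-integrable `[-1, 1] (EFin \o (fun=> 1 : R)).
  by apply: (@segment_integrable _ _ _ 1) => // x _; rewrite normr1.
(* Adding one makes the integrand nonnegative on the segment, as integration
   against a sum of measures requires. *)
have : \int[mu]_(x in `[-1, 1]) (x ^+ k + 1) =
    (\sum_(x <- eigenvalues A) (x ^+ k + 1)) / n.+1%:R.
  rewrite /Rintegral (eq_measure_integral (empirical_spectral_measure A)).
    rewrite (empirical_integral (f := fun x => x ^+ k + 1)) //=.
      exact: measurable_funD.
    by move=> x; rewrite /= in_itv /= => /X1; rewrite ler_norml; lra.
  by move=> B mB _; rewrite muE.
rewrite RintegralD // Rintegral_cst // (congr1 fine mu1) mulr1.
rewrite big_split /= [\sum_(_ <- _) 1]big_const_seq count_predT An iter_addr_0.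
by rewrite mulrDl divff ?pnatr_eq0 // => /addIr.
Qed.

Lemma wasserstein_eq (R : realType) (mu mu' nu nu' : {measure set R -> \bar R}) p :
  (forall A, measurable A -> mu A = mu' A) -> (forall A, measurable A -> nu A = nu' A) ->
  wasserstein p mu nu = wasserstein p mu' nu'.
Proof.
move=> mumu' nunu'; rewrite /wasserstein (_ : coupling mu nu = coupling mu' nu') //.
by apply/seteqP; split=> Pi PiC A mA; have [-> ->] := PiC A mA; rewrite mumu' ?nunu'.
Qed.

Lemma integral_moment (R : realType) (mu : probability R R) k :
  (\int[mu]_(x in `[(-1)%R, 1%R]) (x ^+ k)%:E = (moment mu k)%:E)%E.
Proof.
rewrite /moment /Rintegral fineK //; apply: integrable_fin_num => //.
apply: (@segment_integrable _ _ (fun x => x ^+ k) 1) => // x x11.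
by rewrite normrX exprn_ile1 // ler_norml.
Qed.

Lemma moment0 (R : realType) (mu : probability R R) :
  mu `[-1, 1]%classic = 1%E -> moment mu 0 = 1.
Proof. by move=> mu1; rewrite /moment Rintegral_cst // mul1r (congr1 fine mu1). Qed.

(** Both parities of the characterisation in one formula, since the odd loop moments
    vanish. *)
Lemma limit_momentsP (R : realType) (L mu : probability R R) :
  limit_moments L mu <-> forall m, (0 < m)%N -> moment mu m = loop_moment L m.
Proof.
split=> [muL m m0|muL k k1].
  have [om|em] := boolP (odd m).
    have [|mE _] := muL m.+1./2; first by lia.
    move: mE; rewrite integral_moment (_ : (_ - 1)%N = m); last by lia.
    by case=> ->; rewrite loop_moment_odd.
  have [|_] := muL m./2; first by lia.
  rewrite integral_moment limit_even_momentE.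
  by rewrite (_ : (2 * _)%N = m) => [[]|]; last by lia.
rewrite !integral_moment muL ?muL; [|lia|lia].
by rewrite loop_moment_odd ?limit_even_momentE //; lia.
Qed.

Lemma spectral_cvg (R : realType) (L : probability R R) (v : nat -> R) :
  (forall i, (2 <= i)%N -> 0 <= v i <= 1) ->
  (forall m, \tr (birth_death_kernel n v ^+ m) / n%:R @[n --> \oo] --> loop_moment L m) ->
  exists mu : probability R R, [/\ mu `[-1, 1]%classic = 1%E, moment mu =1 loop_moment L &
    forall p, 1 <= p ->
      wasserstein p (empirical_spectral_measure (birth_death_kernel n v)) mu
        @[n --> \oo] --> 0%E].
Proof.
move=> v01 trc.
have /choice[mu_ muP] n : exists mu : probability R R, [/\
    forall B, measurable B ->
      empirical_spectral_measure (birth_death_kernel n.+1 v) B = mu B,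
    mu `[-1, 1]%classic = 1%E &
    forall k, moment mu k = \tr (birth_death_kernel n.+1 v ^+ k) / n.+1%:R].
  have [sz le1 trE] := birth_death_eigenvalues n.+1 v01.
  have [mu [mE mu1 mm]] := empirical_probability sz le1.
  by exists mu; split=> // k; rewrite mm trE.
have mu1 n : mu_ n `[-1, 1]%classic = 1%E by have [] := muP n.
have mcvg k : moment (mu_ n) k @[n --> \oo] --> loop_moment L k.
  have -> : (fun n => moment (mu_ n) k) =
      fun n => \tr (birth_death_kernel n.+1 v ^+ k) / n.+1%:R.
    by apply/funext => n; have [_ _ ->] := muP n.
  by have := trc k; rewrite -cvg_shiftS.
have [mu [mu11 muM muW]] := cvg_moments_wasserstein mu1 mcvg.
exists mu; split=> // p p1.
rewrite -cvg_shiftS; move: (muW p p1).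
rewrite (_ : (fun n => wasserstein p (mu_ n) mu) = [sequence
  wasserstein p (empirical_spectral_measure (birth_death_kernel n.+1 v)) mu]_n) //.
apply/funext => n; apply: wasserstein_eq => // B mB; have [-> //] := muP n.
Qed.

Theorem corollary1p7 (R : realType) (d : measure_display)
    (Omega : measurableType d) (P : probability Omega R)
    (L : probability R R) (L01 : L `[0, 1]%classic = 1%E)
    (V : nat -> {RV P >-> R}) (V_iid : iid [set i | (2 <= i)%N] V L) :
  exists mu : probability R R,
    [/\ mu `[-1, 1]%classic = 1%E,
        {ae P, forall w, forall p : R, 1 <= p ->
          wasserstein p
            (empirical_spectral_measure
               (birth_death_kernel n (fun i => V i w)))
            mu @[n --> \oo] --> 0%E},
        limit_moments L mu &
        forall nu : probability R R, nu `[-1, 1]%classic = 1%E ->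
          limit_moments L nu ->
          forall A : set R, measurable A -> nu A = mu A].
Proof.
have ae_tr := ae_trace_cvg L01 V_iid.
(* An event of probability one is nonempty, and one of its points gives mu. *)
have [w0 [V01 trc]] : exists w, (forall i, (2 <= i)%N -> 0 <= V i w <= 1) /\
    forall m, \tr (birth_death_kernel n (fun i => V i w) ^+ m) / n%:R
      @[n --> \oo] --> loop_moment L m.
  apply: contrapT => none; have [N [mN N0 sN]] := ae_tr.
  have : P N = 1%E.
    rewrite (_ : N = setT) ?probability_setT //; apply/seteqP; split=> // w _.
    by apply: sN => goodw; apply: none; exists w.
  by move/eqP; rewrite N0 eq_sym onee_eq0.
have [mu [mu1 muM _]] := spectral_cvg V01 trc.
exists mu; split=> //.
- apply: filterS ae_tr => w [V01w trcw] p p1.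
  have [nu [nu1 nuM nuW]] := spectral_cvg V01w trcw.
  have numu : forall A, measurable A -> nu A = mu A.
    by apply: moment_determinacy => // k; rewrite nuM muM.
  have -> : (fun n => wasserstein p
      (empirical_spectral_measure (birth_death_kernel n (fun i => V i w))) mu) =
    fun n => wasserstein p
      (empirical_spectral_measure (birth_death_kernel n (fun i => V i w))) nu.
    by apply/funext => n; apply: wasserstein_eq => // A mA; exact/esym/numu.
  exact: nuW.
- by apply/limit_momentsP => m _; exact: muM.
- move=> nu nu1 /limit_momentsP nuL; apply: moment_determinacy => // -[|k].
    by rewrite !moment0.
  by rewrite nuL // muM.
Qed.
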